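(* Let $d\ge 1$, let $\Sigma\subseteq N_{\mathbb{R}}$ be a simplicial $d$-fan with weight function $\omega:\Sigma(d)\rightarrow\mathbb{R}_{>0}$, let $*\in\mathrm{Inn}(N_{\mathbb{R}})$ be an inner product, and let $z_1,\dots,z_d\in\overline{\mathrm{Cub}}(\Sigma,* )$ be pseudocubical values. Then $$\mathrm{MVol}_{\Sigma,\omega,*}(z_1,\dots,z_d)=\sum_{\rho\in\Sigma(1)}z_{1,\rho}\,\mathrm{MVol}_{\Sigma^\rho,\omega^\rho,*^\rho}(z_2^\rho,\dots,z_d^\rho),$$ where $z_{1,\rho}$ denotes the $\rho$-coordinate of $z_1\in\mathbb{R}^{\Sigma(1)}$.
   Context: **Fans.** $N_{\mathbb{R}}$ is a finite-dimensional real vector space. All fans are (finite) polyhedral fans that are pure (all maximal cones have the same dimension) and marked (a generator $0\neq u_\rho\in\rho$ is chosen for each ray $\rho$). A $d$-fan is such a fan of dimension $d$. $\Sigma(k)$ is the set of $k$-dimensional cones, $\sigma(1)$ the set of rays of $\sigma$, $\preceq$ the face relation, $N_{\sigma,\mathbb{R}}$ the linear span of $\sigma$. $\Sigma$ is simplicial if $\dim N_{\sigma,\mathbb{R}}=|\sigma(1)|$ for all $\sigma\in\Sigma$. $\mathrm{Inn}(N_{\mathbb{R}})$ is the set of inner products on $N_{\mathbb{R}}$. **Pseudocubical values.** For $z\in\mathbb{R}^{\Sigma(1)}$ and $\sigma\in\Sigma$, $w_{\sigma,*}(z)\in N_{\sigma,\mathbb{R}}$ is the unique vector with $w_{\sigma,*}(z)*u_\rho=z_\rho$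 for all $\rho\in\sigma(1)$. $\overline{\mathrm{Cub}}(\Sigma,* )$ is the set of $z$ with $w_{\sigma,*}(z)\in\sigma$ for all $\sigma\in\Sigma$. **Mixed volumes.** Let $P_{\sigma,*}(z)=\{v\in\sigma\mid v*u_\rho\le z_\rho\text{ for all }\rho\in\sigma(1)\}$. Let $M_\sigma\subseteq N_{\sigma,\mathbb{R}}$ be the lattice spanned by the basis dual to $\{u_\rho\mid\rho\in\sigma(1)\}$ with respect to $*$; $\mathrm{Vol}_\sigma$ is the volume on polytopes in $N_{\sigma,\mathbb{R}}$ normalized so that a fundamental simplex of $M_\sigma$ (convex hull of $0$ and a lattice basis) has volume $1$, and $\mathrm{MVol}_\sigma$ is the associated mixed volume of polytopes (symmetric, Minkowski-multilinear, $\mathrm{MVol}_\sigma(P,\dots,P)=\mathrm{Vol}_\sigma(P)$). For pseudocubical values, $$\mathrm{MVol}_{\Sigma,\omega,*}(z_1,\dots,z_d)=\sum_{\sigma\in\Sigma(d)}\omega(\sigma)\mathrm{MVol}_\sigma(P_{\sigma,*}(z_1),\dots,P_{\sigma,*}(z_d)).$$ For a $0$-dimensional fan $\{0\}$, a point has volume $1$, so the mixed volume (of the empty list) is $\omega(\{0\})$. **Stars.** For $\tau\in\Sigma$, let $N^\tau_{\mathbb{R}}=N_{\tau,\mathbb{R}}^\perp\subseteq N_{\mathbb{R}}$ (orthogonal complement for $*$), and let $\mathrm{pr}^\tau:N_{\mathbb{R}}\to N^\tau_{\mathbb{R}}$ be the orthogonal projection. The star $\Sigma^\tau$ is the fan in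 $N^\tau_{\mathbb{R}}$ with cones $\pi^\tau:=\mathrm{pr}^\tau(\pi)$, where $\pi$ ranges over the faces of cones $\sigma\in\Sigma$ with $\tau\preceq\sigma$. The map $\sigma\mapsto\sigma^\tau$ is a bijection from $\{\sigma\in\Sigma\mid\tau\preceq\sigma\}$ to $\Sigma^\tau$, and $\Sigma^\tau$ is a simplicial fan of pure dimension $d-\dim\tau$. Each ray $\eta\in\Sigma^\tau(1)$ is the projection of a unique ray $\hat\eta$ among the rays of these cones, and is marked by $u_\eta=\mathrm{pr}^\tau(u_{\hat\eta})$. $*^\tau$ is the restriction of $*$ to $N^\tau_{\mathbb{R}}$, and $\omega^\tau(\sigma^\tau)=\omega(\sigma)$ for $\sigma\in\Sigma(d)$ with $\tau\preceq\sigma$. For $z\in\mathbb{R}^{\Sigma(1)}$, $z^\tau\in\mathbb{R}^{\Sigma^\tau(1)}$ is defined by $z^\tau_\eta=z_{\hat\eta}-w_{\tau,*}(z)*u_{\hat\eta}$; if $z\in\overline{\mathrm{Cub}}(\Sigma,* )$ then $z^\tau\in\overline{\mathrm{Cub}}(\Sigma^\tau,*^\tau)$. *)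

(* Defs.v *)
From HB Require Import structures.
From mathcomp Require Import all_boot all_order all_algebra perm.
From mathcomp Require Import boolp classical_sets functions reals ereal.
From mathcomp Require Import measure numfun lebesgue_measure lebesgue_integral.

Set Implicit Arguments.
Unset Strict Implicit.
Unset Printing Implicit Defensive.

Import Order.TTheory GRing.Theory Num.Theory.
Local Open Scope classical_set_scope.
Local Open Scope ring_scope.

(* Inner products are the library's [{dot V for idfun}]: symmetric bilinear
   forms [ip] with [0 < ip v v] for [v != 0]. *)
Section RestrictedForm.
Context {R : realType} {V : vectType R}.
Variables (ip : {dot V for idfun}) (U : {vspace V}).

Definition restr_form (x y : subvs_of U) : R := ip (vsval x) (vsval y).

Lemma restr_form_bilinear : bilinear_for *%R (idfun \; *%R) restr_form.
Proof.
split=> [y|x] a u v; rewrite /restr_form.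
  by rewrite (linearP vsval) linearPl.
by rewrite (linearP vsval) linearPr.
Qed.

HB.instance Definition _ :=
  bilinear_isBilinear.Build R (subvs_of U) (subvs_of U) R *%R (idfun \; *%R)
    restr_form restr_form_bilinear.

Lemma restr_form_herm x y :
  restr_form x y = (-1) ^+ false * idfun (restr_form y x).
Proof. exact: hermitian_subproof. Qed.

HB.instance Definition _ :=
  isHermitianSesquilinear.Build R (subvs_of U) false idfun restr_form
    restr_form_herm.

Lemma restr_form_gt0 x : x != 0 -> 0 < restr_form x x.
Proof. by move=> x0; apply: neq0_dnorm_gt0. Qed.

HB.instance Definition _ :=
  isDotProduct.Build R (subvs_of U) restr_form restr_form_gt0.

End RestrictedForm.

Definition restr_dot (R : realType) (V : vectType R) (ip : {dot V for idfun})
    (U : {vspace V}) : {dot (subvs_of U) for idfun} :=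
  @restr_form R V ip U.

(* A fan is recorded through its rays: [I] labels the marked generators, and a
   cone is the set of labels of its rays; the cone itself is [fan_cone]. *)
Record marked_fan (R : realType) (V : vectType R) (I : finType) := MarkedFan {
  cones : {set {set I}};
  mark : I -> V }.

Section Fans.
Context {R : realType} {V : vectType R} {I : finType}.
Implicit Types (F : marked_fan V I) (s t : {set I}) (C D : set V).

Definition fan_cone F s : set V :=
  [set v | exists2 a : I -> R, (forall i, 0 <= a i)
                             & v = \sum_(i in s) a i *: mark F i].

Definition rays F : {set I} := [set i | [set i]%SET \in cones F]%SET.

Definition cone_span F s : {vspace V} := <<[seq mark F i | i <- enum s]>>%VS.

Definition cones_dim F k : {set {set I}} :=
  [set s in cones F | \dim (cone_span F s) == k]%SET.

Definition is_face D C : Prop :=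
  exists2 f : 'Hom(V, R^o), (forall v, C v -> 0 <= (f v : R))
                          & D = [set v | C v /\ f v = 0].

(* [fan_raysP] makes the label set [s] of a cone its set of rays; it forces the
   cones to be strongly convex, which simpliciality requires anyway (a linear
   subspace in a fan has no rays), and the face relation between cones to be
   inclusion of label sets. *)
Record is_fan F : Prop := IsFan {
  fan_neq0 : cones F != finset.set0;
  fan_sub_rays : forall s, s \in cones F -> s \subset rays F;
  fan_mark_neq0 : forall i, i \in rays F -> mark F i != 0;
  fan_inj : {in cones F &, injective (fan_cone F)};
  fan_raysP : forall s i, s \in cones F -> i \in rays F ->
    (i \in s) <-> is_face (fan_cone F [set i]%SET) (fan_cone F s);
  fan_face : forall s D, s \in cones F -> is_face D (fan_cone F s) ->
    exists2 t, t \in cones F & D = fan_cone F t;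
  fan_meet : forall s t, s \in cones F -> t \in cones F ->
    is_face (fan_cone F s `&` fan_cone F t) (fan_cone F s) }.

Definition is_pure F d : Prop := forall s, s \in cones F ->
  (forall t, t \in cones F -> s \subset t -> t = s) ->
  \dim (cone_span F s) = d.

Definition is_simplicial F : Prop :=
  forall s, s \in cones F -> \dim (cone_span F s) = #|s|.

Variable ip : {dot V for idfun}.

(* Elements of [R^(rays F)] are functions [I -> R]; their values at labels that
   are not rays of [F] are never used. *)
Definition wvec F s (z : I -> R) : V :=
  xget 0 [set w | w \in cone_span F s /\
                  forall i, i \in s -> ip w (mark F i) = z i].

Definition pseudocubical F (z : I -> R) : Prop :=
  forall s, s \in cones F -> fan_cone F s (wvec F s z).

Definition truncation F s (z : I -> R) : set V :=
  [set v | fan_cone F s v /\ forall i, i \in s -> ip v (mark F i) <= z i].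

End Fans.

(* The product Lebesgue measure on [R^n], computed by iterated integration. *)
Fixpoint lebesgue_tuple (R : realType) (n : nat) :
    set (n.-tuple R) -> \bar R :=
  match n with
  | 0 => fun A => (\1_A [tuple])%:E
  | n'.+1 => fun A => (\int[@lebesgue_measure R]_x
       @lebesgue_tuple R n' [set y | A (cons_tuple (x : R) y)])%E
  end.

Section MixedVolumes.
Context {R : realType} {V : vectType R}.
Variable ip : {dot V for idfun}.

Definition is_polytope (P : set V) : Prop :=
  [/\ P !=set0, (exists M : R, forall v, P v -> ip v v <= M)
    & exists hs : seq (V * R),
        P = [set v | forall h, h \in hs -> ip v h.1 <= h.2]].

Definition minkowski (a b : R) (P Q : set V) : set V :=
  [set a *: p + b *: q | p in P & q in Q].

Definition minkowski_sum d (S : {set 'I_d}) (P : 'I_d -> set V) : set V :=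
  [set v | exists2 p : 'I_d -> V, (forall k, k \in S -> P k (p k))
                                & v = \sum_(k in S) p k].

Definition replace_at d (P : 'I_d -> set V) (k : 'I_d) (Q : set V) :
    'I_d -> set V :=
  fun l => if l == k then Q else P l.

Definition polytope_in (U : {vspace V}) (P : set V) : Prop :=
  is_polytope P /\ (forall v, P v -> v \in U).

Record is_mixed_volume (U : {vspace V}) (vol : set V -> R) d
    (mv : ('I_d -> set V) -> R) : Prop := IsMixedVolume {
  mv_sym : forall (P : 'I_d -> set V) (pi : {perm 'I_d}),
    (forall k, polytope_in U (P k)) -> mv (fun k => P (pi k)) = mv P;
  mv_lin : forall (P : 'I_d -> set V) (k : 'I_d) (Q Q' : set V) (a b : R),
    (forall l, polytope_in U (P l)) -> polytope_in U Q -> polytope_in U Q' ->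
    0 <= a -> 0 <= b ->
    mv (replace_at P k (minkowski a b Q Q')) =
      a * mv (replace_at P k Q) + b * mv (replace_at P k Q');
  mv_diag : forall P : set V, polytope_in U P -> mv (fun=> P) = vol P }.

Definition polarization (vol : set V -> R) d (P : 'I_d -> set V) : R :=
  (d`!%:R)^-1 *
  \sum_(S : {set 'I_d}) (-1) ^+ (d - #|S|) * vol (minkowski_sum S P).

(* The functional singled out by [is_mixed_volume]. It exists for volumes, by
   Minkowski's theorem, and its values on polytopes are unique, being given by
   the polarization formula; that formula is therefore the default. *)
Definition mixed_volume (U : {vspace V}) (vol : set V -> R) d :
    ('I_d -> set V) -> R :=
  xget (@polarization vol d) [set mv | is_mixed_volume U vol mv].

End MixedVolumes.

Section FanMixedVolumes.
Context {R : realType} {V : vectType R} {I : finType}.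
Variables (ip : {dot V for idfun}) (F : marked_fan V I).

Definition dual_mark (s : {set I}) (i : I) : V :=
  wvec ip F s (fun j => (j == i)%:R).

Definition dual_coord (s : {set I}) (y : #|s|.-tuple R) : V :=
  \sum_(k < #|s|) tnth y k *: dual_mark s (enum_val k).

Definition fundamental_simplex (s : {set I}) : set V :=
  [set v | exists a : I -> R,
    [/\ forall i, 0 <= a i, \sum_(i in s) a i <= 1
      & v = \sum_(i in s) a i *: dual_mark s i]].

(* The lattice [M_s] is spanned by the dual basis, so its fundamental simplex is
   the one above. Coordinates in the dual basis serve to measure [cone_span];
   in any other basis the quotient is the same. *)
Definition cone_vol (s : {set I}) (P : set V) : R :=
  fine (lebesgue_tuple (@dual_coord s @^-1` P)) /
  fine (lebesgue_tuple (@dual_coord s @^-1` fundamental_simplex s)).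

Definition MVol (w : {set I} -> R) d (z : 'I_d -> I -> R) : R :=
  \sum_(s in cones_dim F d)
    w s * mixed_volume ip (cone_span F s) (cone_vol s)
            (fun k => truncation ip F s (z k)).

End FanMixedVolumes.

Section Stars.
Context {R : realType} {V : vectType R} {I : finType}.
Variables (ip : {dot V for idfun}) (F : marked_fan V I) (t : {set I}).

Definition star_space : {vspace V} := orthov ip (cone_span F t).

Definition star_proj (v : V) : subvs_of star_space :=
  vsproj star_space (daddv_pi star_space (cone_span F t) v).

(* The rays of the star keep the labels of the rays they are projected from:
   those in [t] are projected to 0, so [p^t] has label set [p :\: t]. *)
Definition star : marked_fan (subvs_of star_space) I :=
  {| cones := [set p :\: t | p in cones F
                & [exists s in cones F, (t \subset s) && (p \subset s)]]%SET;
     mark := fun i => star_proj (mark F i) |}.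

Definition star_dot : {dot (subvs_of star_space) for idfun} :=
  restr_dot ip star_space.

(* The cone [s] containing [t] with [s^t] labelled by [p] is [t :|: p]. *)
Definition star_weight (w : {set I} -> R) (p : {set I}) : R := w (t :|: p)%SET.

Definition star_value (z : I -> R) (i : I) : R :=
  z i - ip (wvec ip F t z) (mark F i).

End Stars.

(* Main.v *)
Require Import Defs.
From HB Require Import structures.
From mathcomp Require Import all_boot all_order all_algebra perm.
From mathcomp Require Import boolp reals.
From mathcomp Require Import ring lra.

(* In the coordinates [y_k = v * u_k] on the span of a cone, both sides of the
   recursion depend only on the Gram matrix of the marks: passing to the star at
   a ray [j] takes a Schur complement, and the truncated cone is
   [{g a | a >= 0, g a <= z}]. It is the union of the pyramids with apex 0 over
   the facets [y_j = z_j], which overlap in null sets, and the slices of the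
   pyramid over the facet [j] are translates of truncations of the star at [j].
   Induction on the dimension gives [Vol = sum_j z_j * Vol(star at j)] on each
   cone, so the volume is the diagonal of the multilinear form [cone_mvol] that
   satisfies the recursion by construction. This form is symmetric because
   Schur complements at two rays commute, so by polarization it is the mixed
   volume; truncation is Minkowski additive on pseudocubical values by the same
   decomposition into pyramids. Summing over the maximal cones and exchanging
   sums gives the theorem. *)

Set Implicit Arguments.
Unset Strict Implicit.
Unset Printing Implicit Defensive.

Import Order.TTheory GRing.Theory Num.Theory.
Local Open Scope ring_scope.

(** * Truncated cones in Gram coordinates *)

(** Each star lives in a new orthogonal complement, so an induction through stars of stars would
    change the vector space at every step. Gram matrices on the fixed label type [I] avoid this:
    only the matrix and the label set change. The obstacle is the pyramid decomposition. For general
    values, a point of the star's truncation lifted to the hyperplane [y_j = z_j] may get a negative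
    coefficient on [u_j] and so leave the cone; the facet would then be only part of the star's
    truncation. Pseudocubicality of all faces excludes this ([star_incone_le]), which is why [pscub]
    ranges over all subsets of [s]. The coordinates [y_k] are those in the basis dual to the marks,
    the one that normalizes the volume. Hence no determinant appears, and the only constant is the
    n! coming from the fundamental simplex. *)

Lemma cardsD1S (I : finType) (s : {set I}) j n : j \in s -> #|s| = n.+1 -> #|s :\ j| = n.
Proof. by move=> js; rewrite (cardsD1 j) js => -[]. Qed.

Section Gram.
Context {R : realType} {I : finType}.
Implicit Types (g : I -> I -> R) (s t : {set I}) (z a : I -> R).

(* If [g] is the Gram matrix of the marks of a cone, [schur_val g j z] is the star
   value [z^j] and [schur g j] the Gram matrix of the marks of the star at [j]. *)
Definition schur_val g j z : I -> R := fun k => z k - g k j / g j j * z j.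

Definition schur g j : I -> I -> R := fun k l => schur_val g j (g^~ l) k.

Definition gram_app g s a : I -> R := fun k => \sum_(l in s) g k l * a l.

(** Definiteness concerns the labels in [s] alone, because marks outside a cone may depend linearly
    on those inside. *)
Record pos_def g s : Prop := PosDef {
  pd_sym : forall i j, g i j = g j i;
  pd_gt0 : forall a, (exists2 i, i \in s & a i != 0) ->
    0 < \sum_(i in s) a i * gram_app g s a i }.

Lemma eq_gram_app g s a a' : {in s, a =1 a'} -> gram_app g s a =1 gram_app g s a'.
Proof. by move=> e k; apply: eq_bigr => l ls; rewrite e. Qed.

Lemma gram_appD g s a a' k :
  gram_app g s (a \+ a') k = gram_app g s a k + gram_app g s a' k.
Proof. by rewrite -big_split; apply: eq_bigr => l _; rewrite mulrDr. Qed.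

Lemma gram_appZ g s c a k :
  gram_app g s (fun i => c * a i) k = c * gram_app g s a k.
Proof. by rewrite mulr_sumr; apply: eq_bigr => l _; rewrite mulrCA. Qed.

Lemma pd_diag g s i : pos_def g s -> i \in s -> 0 < g i i.
Proof.
move=> gs is_; have := pd_gt0 gs (a := fun k => (k == i)%:R).
rewrite (big_setD1 i)//= eqxx mul1r [X in _ + X]big1 => [|k]; last first.
  by rewrite !inE => /andP[/negPf -> _]; rewrite mul0r.
rewrite /gram_app (big_setD1 i)//= eqxx mulr1 [X in _ + X + _]big1 => [|k]; last first.
  by rewrite !inE => /andP[/negPf -> _]; rewrite mulr0.
by rewrite !addr0; apply; exists i; rewrite ?eqxx ?oner_neq0.
Qed.

Lemma pd_diag_neq0 g s i : pos_def g s -> i \in s -> g i i != 0.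
Proof. by move=> gs is_; rewrite gt_eqF// (pd_diag gs is_). Qed.

(** The mark [j] projects to 0 in the star, so the coefficient [a j] cancels between the two terms
    of [schur_val]. *)
Lemma gram_app_schur g s j a k : j \in s -> g j j != 0 ->
  gram_app (schur g j) (s :\ j) a k = schur_val g j (gram_app g s a) k.
Proof.
move=> js gj; rewrite /schur_val /gram_app mulr_sumr -sumrB [RHS](big_setD1 j)//=.
rewrite mulrA divfK// subrr add0r; apply: eq_bigr => l _.
by rewrite /schur /schur_val mulrBl mulrA.
Qed.

(* The value at [j] is the solution of [gram_app g s b j = x]. *)
Definition lift_coef g s j (x : R) a : I -> R := fun l =>
  if l == j then (x - \sum_(l in s :\ j) g j l * a l) / g j j else a l.

Lemma lift_coefE g s j x a l : l \in s :\ j -> lift_coef g s j x a l = a l.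
Proof. by rewrite !inE /lift_coef => /andP[/negPf->]. Qed.

Lemma gram_app_lift g s j x a : j \in s -> g j j != 0 ->
  gram_app g s (lift_coef g s j x a) j = x.
Proof.
move=> js gj; rewrite /gram_app (big_setD1 j)//= /lift_coef eqxx mulrC divfK//.
rewrite [X in _ + X](eq_bigr (fun l => g j l * a l)) ?subrK//.
by move=> l; rewrite !inE => /andP[/negPf->].
Qed.

(** Orthogonal decomposition of the lifted vector: its part orthogonal to the mark [j] has the
    products computed in the star, and its part along the mark [j] is fixed by the prescribed
    product [x]. *)
Lemma gram_app_lift_schur g s j x a k : j \in s -> g j j != 0 ->
  gram_app g s (lift_coef g s j x a) k =
  gram_app (schur g j) (s :\ j) a k + g k j / g j j * x.
Proof.
move=> js gj.
rewrite -(@eq_gram_app _ _ (lift_coef g s j x a)); last first.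
  by move=> l; apply: lift_coefE.
by rewrite gram_app_schur// /schur_val gram_app_lift// subrK.
Qed.

Lemma schur_sym g j k l : (forall i i', g i i' = g i' i) ->
  schur g j k l = schur g j l k.
Proof. by move=> gC; rewrite /schur /schur_val (gC k l) (gC k j) (gC l j); ring. Qed.

Lemma pd_schur g s j : pos_def g s -> j \in s -> pos_def (schur g j) (s :\ j).
Proof.
move=> gs js; have gj := pd_diag_neq0 gs js.
split=> [i k|a [i ij ai]]; first exact/schur_sym/(pd_sym gs).
(* The lift with product 0 is the vector of the star seen in the original span, so the two quadratic
   forms agree on it. *)
pose b := lift_coef g s j 0 a.
have := pd_gt0 gs (a := b); rewrite (big_setD1 j)//= gram_app_lift// mulr0 add0r.
rewrite (eq_bigr (fun i => a i * gram_app (schur g j) (s :\ j) a i)).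
  apply; exists i; last by rewrite /b lift_coefE.
  by move: ij; rewrite !inE => /andP[].
by move=> k ks; rewrite /b lift_coefE// gram_app_lift_schur// mulr0 addr0.
Qed.

Lemma pd_inj g s a : pos_def g s -> {in s, forall k, gram_app g s a k = 0} ->
  {in s, forall k, a k = 0}.
Proof.
move=> gs a0 k ks; apply/eqP; apply: contraT => ak.
have := pd_gt0 gs (a := a); rewrite big1 ?ltxx; first by apply; exists k.
by move=> i /a0 ->; rewrite mulr0.
Qed.

(** Gaussian elimination: the system is solved in the star at [j], and the coefficient at [j] is
    then chosen to meet the equation of [j]. *)
Lemma gram_app_surj g s z : pos_def g s ->
  exists a, {in s, forall k, gram_app g s a k = z k}.
Proof.
move: {2}#|s| (erefl #|s|) => n; elim: n => [|n IH] in g s z * => sn gs.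
  by exists z => k; move/eqP: sn; rewrite cards_eq0 => /eqP->; rewrite inE.
have [j js] : exists j, j \in s by apply/set0Pn; rewrite -cards_eq0 sn.
have [a aE] := IH (schur g j) (s :\ j) (schur_val g j z)
  (cardsD1S js sn) (pd_schur gs js).
have gj := pd_diag_neq0 gs js.
exists (lift_coef g s j (z j) a) => k ks; have [->|kj] := eqVneq k j.
  by rewrite gram_app_lift.
by rewrite gram_app_lift_schur// aE ?inE ?kj// subrK.
Qed.

(* [a] lists the coefficients on the marks of a point of the truncated cone. *)
Definition incone g s z a :=
  (forall i, i \in s -> 0 <= a i) /\ (forall k, k \in s -> gram_app g s a k <= z k).

(* Pseudocubicality on the cone [s] and all its faces [t]: [a] lists the
   coefficients of [w_t(z)] on the marks. *)
Definition pscub g s z := forall t, t \subset s -> exists2 a,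
  forall i, i \in t -> 0 <= a i & forall k, k \in t -> gram_app g t a k = z k.

Lemma schur_valD g j z z' k :
  schur_val g j (z \+ z') k = schur_val g j z k + schur_val g j z' k.
Proof. by rewrite /schur_val /=; ring. Qed.

Lemma schur_valZ g j c z k : schur_val g j (fun i => c * z i) k = c * schur_val g j z k.
Proof. by rewrite /schur_val /=; ring. Qed.

(** The face [t] of the star comes from the face [j |: t], and projecting kills the mark [j] while
    keeping the other coefficients. *)
Lemma pscub_schur g s j z : pos_def g s -> j \in s -> pscub g s z ->
  pscub (schur g j) (s :\ j) (schur_val g j z).
Proof.
move=> gs js zs t ts.
have jt : j \notin t by apply/negP => /(subsetP ts); rewrite !inE eqxx.
have [|a a0 az] := zs (j |: t).
  by apply/subsetP => i /setU1P[->//|/(subsetP ts)]; rewrite inE => /andP[].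
exists a => [i it|k kt]; first by rewrite a0// inE it orbT.
rewrite -[t in gram_app _ t](setU1K jt) gram_app_schur ?setU11 ?(pd_diag_neq0 gs js)//.
by rewrite /schur_val !az ?setU11// inE kt orbT.
Qed.

Lemma pscub_ge0 g s z i : pos_def g s -> pscub g s z -> i \in s -> 0 <= z i.
Proof.
move=> gs zs is_; have [|a a0 az] := zs [set i]; first by rewrite sub1set.
rewrite -az ?inE// /gram_app big_set1 mulr_ge0 ?a0 ?inE//.
exact/ltW/(pd_diag gs).
Qed.

Lemma pscubD g s z z' : pscub g s z -> pscub g s z' -> pscub g s (z \+ z').
Proof.
move=> zs zs' t ts; have [a a0 az] := zs t ts; have [a' a0' az'] := zs' t ts.
exists (a \+ a') => [i it|k kt]; first by rewrite addr_ge0 ?a0 ?a0'.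
by rewrite gram_appD az// az'.
Qed.

Lemma pscubZ g s c z : 0 <= c -> pscub g s z -> pscub g s (fun i => c * z i).
Proof.
move=> c0 zs t ts; have [a a0 az] := zs t ts.
exists (fun i => c * a i) => [i it|k kt]; first by rewrite mulr_ge0 ?a0.
by rewrite gram_appZ az.
Qed.

Lemma pscub0 g s : pscub g s (fun=> 0).
Proof.
move=> t _; exists (fun=> 0) => // k _.
by rewrite /gram_app big1// => l _; rewrite mulr0.
Qed.

Lemma inconeZ g s z c a : (forall i, i \in s -> 0 <= z i) -> 0 <= c <= 1 ->
  incone g s z a -> incone g s z (fun i => c * a i).
Proof.
move=> z0 /andP[c0 c1] [a0 az]; split=> [i /a0|k ks]; first exact: mulr_ge0.
rewrite gram_appZ; apply: (le_trans (ler_wpM2l c0 (az k ks))).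
by rewrite ler_piMl// z0.
Qed.

Lemma incone_schur g s j z a : pos_def g s -> j \in s -> incone g s z a ->
  gram_app g s a j = z j -> incone (schur g j) (s :\ j) (schur_val g j z) a.
Proof.
move=> gs js [a0 az] aj; split=> [i|k]; rewrite inE => /andP[_ ?]; first exact: a0.
by rewrite gram_app_schur ?(pd_diag_neq0 gs js)// /schur_val aj lerD2r az.
Qed.

(* A nonzero point of the truncated cone lies in the pyramid with apex 0 over
   one of the facets [gram_app g s a j = z j]. *)
Lemma incone_pyramid g s z a i : pos_def g s -> (forall i, i \in s -> 0 <= z i) ->
  incone g s z a -> i \in s -> a i != 0 ->
  exists2 j, j \in s & 0 < gram_app g s a j /\
    forall k, k \in s -> gram_app g s a k * z j <= z k * gram_app g s a j.
Proof.
move=> gs z0 [a0 az] is_ ai; set y := gram_app g s a.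
(* The squared norm of the point is the sum of the [a i * y i]; it is positive, so some [y i] is. *)
have /exists_inP[j0 j0s y0] : [exists j in s, 0 < y j].
  apply/exists_inP; apply/not_exists2P => H.
  have := pd_gt0 gs (ex_intro2 _ (fun i => a i != 0) i is_ ai).
  apply/negP; rewrite -leNgt.
  apply: sumr_le0 => k ks; rewrite mulr_ge0_le0 ?a0//.
  by have [/(_ ks)|/negP] := H k; rewrite // leNgt.
(* The ray from 0 through the point first meets the facet where [y k / z k] is largest. Clearing
   denominators in the conclusion also covers labels with [z k = 0]. *)
have := @arg_maxP _ _ _ j0 [pred k | (k \in s) && (0 < y k)] (fun k => y k / z k).
case=> [|j /= /andP[js yj] jmax]; first by rewrite /= j0s.
have zj : 0 < z j by apply: lt_le_trans yj (az _ js).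
exists j => //; split=> // k ks.
have [yk|yk] := ltP 0 (y k); last first.
  by apply: (@le_trans _ _ 0); rewrite ?mulr_ge0 ?z0 ?(ltW yj)// mulr_le0_ge0// ltW.
have zk : 0 < z k by apply: lt_le_trans yk (az _ ks).
have := jmax k; rewrite /= ks yk => /(_ isT); rewrite ler_pdivrMr//.
by rewrite mulrAC ler_pdivlMr// (mulrC (y j)).
Qed.

Lemma incone_facet g s z a i : pos_def g s -> (forall i, i \in s -> 0 <= z i) ->
  incone g s z a -> i \in s -> a i != 0 ->
  exists2 j, j \in s & exists2 c, 0 < c <= 1 &
    incone g s z (fun i => c^-1 * a i) /\
    gram_app g s (fun i => c^-1 * a i) j = z j.
Proof.
move=> gs z0 az is_ ai; have [j js [yj jmax]] := incone_pyramid gs z0 az is_ ai.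
have zj : 0 < z j by apply: lt_le_trans yj (az.2 _ js).
exists j => //; exists (gram_app g s a j / z j).
  by rewrite divr_gt0// ler_pdivrMr// mul1r az.2.
split; last by rewrite gram_appZ invf_div divfK// gt_eqF.
split=> [k ks|k ks]; first by rewrite mulr_ge0 ?az.1// invr_ge0 divr_ge0// ltW.
by rewrite gram_appZ invf_div mulrC mulrA ler_pdivrMr// jmax.
Qed.

(* Scaling [a] into a facet [k] of the star and projecting along [k] instead of
   [j] turns the claim for [j] into the same claim for the star of [k]. *)
Lemma star_incone_le g s j z a : pos_def g s -> pscub g s z -> j \in s ->
  incone (schur g j) (s :\ j) (schur_val g j z) a ->
  \sum_(l in s :\ j) g j l * a l <= z j.
Proof.
move: {2}#|s| (erefl #|s|) => n; elim: n => [|n IH] in g s j z a *.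
  by move/eqP; rewrite cards_eq0 => /eqP-> ? ?; rewrite inE.
move=> sn gs zs js az; have zj := pscub_ge0 gs zs js.
have gj := pd_diag_neq0 gs js.
have [/existsP[i /andP[ij ai]]|/existsPn a0] :=
    boolP [exists i, (i \in s :\ j) && (a i != 0)]; last first.
  by rewrite big1// => l lj; have := a0 l; rewrite lj/= negbK => /eqP->; rewrite mulr0.
have gsj := pd_schur gs js; have zsj := pscub_schur gs js zs.
have [k ksj [c /andP[c0 c1] [bz bk]]] :=
  incone_facet gsj (fun i => pscub_ge0 gsj zsj (i := i)) az ij ai.
set b := fun i => c^-1 * a i in bz bk.
suff bj : \sum_(l in s :\ j) g j l * b l <= z j.
  rewrite (eq_bigr (fun l => c * (g j l * b l))) => [|l _]; last first.
    by rewrite /b [RHS]mulrCA mulVKf ?gt_eqF.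
  by rewrite -mulr_sumr (le_trans (ler_wpM2l (ltW c0) bj))// ler_piMl.
have /andP[kj ks] : (k != j) && (k \in s) by move: ksj; rewrite !inE.
have gk := pd_diag_neq0 gs ks.
(* This lift lies on the facets [j] and [k] at once, so it can be projected along [k] as well as
   along [j]. *)
pose b' := lift_coef g s j (z j) b.
have bj' : gram_app g s b' j = z j by rewrite gram_app_lift.
have bk' : gram_app g s b' k = z k.
  by rewrite gram_app_lift_schur// bk /schur_val subrK.
have ble l : l \in s -> gram_app g s b' l <= z l.
  have [->|lj ls] := eqVneq l j; first by rewrite bj'.
  rewrite gram_app_lift_schur// -lerBrDr; apply: bz.2.
  by rewrite !inE lj.
have gsk := pd_schur gs ks; have zsk := pscub_schur gs ks zs.
have jsk : j \in s :\ k by rewrite !inE eq_sym kj.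
have gkj := pd_diag_neq0 gsk jsk.
have bkj : gram_app (schur g k) (s :\ k) b' j = schur_val g k z j.
  by rewrite gram_app_schur// /schur_val bj' bk'.
have b'z : incone (schur (schur g k) j) (s :\ k :\ j)
    (schur_val (schur g k) j (schur_val g k z)) b'.
  split=> [l|l]; rewrite !inE => /andP[lj /andP[lk ls]].
    by rewrite /b' lift_coefE ?bz.1 ?inE ?lj.
  rewrite gram_app_schur// [schur_val _ _ _ l]/schur_val bkj lerD2r.
  by rewrite gram_app_schur// /schur_val bk' lerD2r ble.
(* The bound [schur_val g k z j] equals [gram_app (schur g k) (s :\ k) b' j], whose sum exceeds the
   left-hand side by the term of [j]. That term is thus nonnegative, hence so is [b' j], whose
   numerator is the difference to be bounded. *)
have := IH _ _ _ _ b' (cardsD1S ks sn) gsk zsk jsk b'z.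
rewrite -bkj /gram_app [leRHS](big_setD1 j)//= lerDr pmulr_rge0 ?(pd_diag gsk jsk)//.
by rewrite /b' /lift_coef eqxx pmulr_lge0 ?invr_gt0 ?(pd_diag gs js)// subr_ge0.
Qed.

(** Converse of [incone_schur]: the facet [y_j = z_j] is a full copy of the star's truncation. The
    coefficient on the mark [j] is nonnegative by [star_incone_le]. *)
Lemma incone_lift g s j z a : pos_def g s -> pscub g s z -> j \in s ->
  incone (schur g j) (s :\ j) (schur_val g j z) a ->
  incone g s z (lift_coef g s j (z j) a).
Proof.
move=> gs zs js az; have gj := pd_diag_neq0 gs js; split=> [i is_|k ks].
  have [->|ij] := eqVneq i j; last by rewrite lift_coefE ?az.1 ?inE ?ij.
  rewrite /lift_coef eqxx divr_ge0 ?(ltW (pd_diag gs js))// subr_ge0.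
  exact: star_incone_le.
have [->|kj] := eqVneq k j; first by rewrite gram_app_lift.
by rewrite gram_app_lift_schur// -lerBrDr az.2// !inE kj.
Qed.

Lemma incone_add g s z z' a a' :
  incone g s z a -> incone g s z' a' -> incone g s (z \+ z') (a \+ a').
Proof.
move=> [a0 az] [a0' az']; split=> [i is_|k ks]; first by rewrite addr_ge0 ?a0 ?a0'.
by rewrite gram_appD lerD ?az ?az'.
Qed.

(** The hard inclusion of Minkowski additivity. The point is scaled out to a facet [j] of the
    truncation at [z \+ z'] and split in the star at [j] by induction; the two parts are lifted to
    the facets [y_j = z_j] and [y_j = z'_j] and scaled back. *)
Lemma incone_split g s z z' a : pos_def g s -> pscub g s z -> pscub g s z' ->
  incone g s (z \+ z') a ->
  exists b b', [/\ incone g s z b, incone g s z' b' & {in s, a =1 b \+ b'}].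
Proof.
move: {2}#|s| (erefl #|s|) => n; elim: n => [|n IH] in g s z z' a *.
  move/eqP; rewrite cards_eq0 => /eqP-> _ _ _ _.
  by exists a, a; split=> [||i]; rewrite ?inE//; split=> i; rewrite inE.
move=> sn gs zs zs' az; have zzs := pscubD zs zs'.
have z0 i := pscub_ge0 gs zs (i := i); have z0' i := pscub_ge0 gs zs' (i := i).
have [/existsP[i /andP[is_ ai]]|/existsPn a0] :=
    boolP [exists i, (i \in s) && (a i != 0)]; last first.
  exists (fun=> 0), (fun=> 0); split=> [||i is_]; last first.
  - by have := a0 i; rewrite is_/= negbK addr0 => /eqP.
  - split=> // k ks; rewrite /gram_app big1 ?z0'// => l _; exact: mulr0.
  - split=> // k ks; rewrite /gram_app big1 ?z0// => l _; exact: mulr0.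
have [j js [c /andP[c0 c1] [bz bj]]] :=
  incone_facet gs (fun i => pscub_ge0 gs zzs (i := i)) az is_ ai.
set b := fun i => c^-1 * a i in bz bj.
have gj := pd_diag_neq0 gs js; have gsj := pd_schur gs js.
have bzj : incone (schur g j) (s :\ j) (schur_val g j z \+ schur_val g j z') b.
  have [b0 bz'] := incone_schur gs js bz bj.
  by split=> // k ks; rewrite /= -schur_valD bz'.
have [d [d' [dz dz' bd]]] := IH _ _ _ _ _ (cardsD1S js sn) gsj
  (pscub_schur gs js zs) (pscub_schur gs js zs') bzj.
pose e := lift_coef g s j (z j) d; pose e' := lift_coef g s j (z' j) d'.
have c01 : 0 <= c <= 1 by rewrite ltW.
exists (fun i => c * e i), (fun i => c * e' i); split.
- exact/inconeZ/incone_lift.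
- exact/inconeZ/incone_lift.
move=> k ks; rewrite /= -mulrDr.
have -> : a k = c * b k by rewrite /b mulVKf ?gt_eqF.
congr (_ * _); have [->|kj] := eqVneq k j; last first.
  by rewrite /e /e' !lift_coefE ?bd ?inE ?kj.
(* The products of the two lifts with the mark [j] add up to that of [b], and the other coefficients
   already agree, so the coefficients at [j] agree too. *)
rewrite /e /e' /lift_coef eqxx -mulrDl addrACA -opprD -big_split/=.
apply/(canRL (mulfK gj)); rewrite -[z j + z' j]bj /gram_app (big_setD1 j)//=.
rewrite (eq_bigr (fun l => g j l * d l + g j l * d' l)) ?addrK 1?mulrC//.
by move=> l ls; rewrite bd//= mulrDr.
Qed.
End Gram.

(** * Mixed volumes of truncated cones and polarization *)

Section ConeMixedVolume.
Context {R : realType} {I : finType}.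
Implicit Types (g : I -> I -> R) (s t : {set I}) (z a : I -> R).

(* [f] accumulates the maps [schur_val] of the successive stars. *)
Fixpoint cone_mvol_rec g s (f : (I -> R) -> I -> R) (zs : seq (I -> R)) : R :=
  if zs is z :: zs' then
    \sum_(i in s) f z i * cone_mvol_rec (schur g i) (s :\ i) (schur_val g i \o f) zs'
  else 1.

Definition cone_mvol g s zs := cone_mvol_rec g s id zs.

Lemma cone_mvol_rec_map g s f f' zs :
  cone_mvol_rec g s (f \o f') zs = cone_mvol_rec g s f (map f' zs).
Proof.
elim: zs g s f => [//|z zs IH] g s f.
by apply: eq_bigr => i _; congr (_ * _); exact: IH.
Qed.

(** The accumulator keeps the fixpoint structural, since a mapped tail is no subterm of the list.
    Pushed back into the list, it yields the recursion of the theorem on a single cone. *)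
Lemma cone_mvol_cons g s z zs : cone_mvol g s (z :: zs) =
  \sum_(i in s) z i * cone_mvol (schur g i) (s :\ i) [seq schur_val g i z' | z' <- zs].
Proof. by apply: eq_bigr => i _; congr (_ * _); exact: (cone_mvol_rec_map _ _ id). Qed.

(** Both sides remove the components along the plane of the marks [i] and [j]; the order of the two
    projections does not matter. *)
Lemma schur_valC g s i j z : pos_def g s -> i \in s -> j \in s -> i != j ->
  schur_val (schur g i) j (schur_val g i z) = schur_val (schur g j) i (schur_val g j z).
Proof.
move=> gs is_ js ij; apply/funext => k.
have gi := pd_diag_neq0 gs is_; have gj := pd_diag_neq0 gs js.
have := pd_diag_neq0 (pd_schur gs is_) (i := j).
have := pd_diag_neq0 (pd_schur gs js) (i := i).
rewrite !inE ij (eq_sym j) ij is_ js => /(_ isT) gij /(_ isT) gji.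
move: gij gji; rewrite /schur /schur_val (pd_sym gs j i) => gij gji.
field.
(* The remaining denominator is the Gram determinant of the two marks, which factors into two
   successive pivots. *)
have e : g i i * g j j - g i j ^+ 2 = (g j j - g i j / g i i * g i j) * g i i.
  by field.
by rewrite e !mulf_neq0// gi gj.
Qed.

Lemma schurC g s i j : pos_def g s -> i \in s -> j \in s -> i != j ->
  schur (schur g i) j = schur (schur g j) i.
Proof.
move=> gs is_ js ij; apply/funext => k; apply/funext => l.
exact: (congr1 (@^~ k) (schur_valC (g^~ l) gs is_ js ij)).
Qed.

(** Two levels of the recursion give a sum over ordered pairs of distinct rays with the weight
    [N i j]. The correction from [schur_val] is already symmetric in [z] and [z']; the main term
    becomes so by exchanging [i] and [j], as [N] is symmetric. *)
Lemma cone_mvol_swap g s z z' zs : pos_def g s ->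
  cone_mvol g s [:: z, z' & zs] = cone_mvol g s [:: z', z & zs].
Proof.
move=> gs.
pose N i j := cone_mvol (schur (schur g i) j) (s :\ i :\ j)
  [seq schur_val (schur g i) j (schur_val g i u) | u <- zs].
have NC i j : i \in s -> j \in s -> i != j -> N i j = N j i.
  move=> is_ js ij; rewrite /N (schurC gs is_ js ij) setDDl setUC -setDDl.
  by congr cone_mvol; apply: eq_map => u; apply: (schur_valC _ gs is_ js ij).
have E u u' : cone_mvol g s [:: u, u' & zs] =
    \sum_(i in s) \sum_(j in s :\ i) u i * u' j * N i j -
    \sum_(i in s) \sum_(j in s :\ i) g j i / g i i * (u i * u' i) * N i j.
  rewrite cone_mvol_cons -sumrB; apply: eq_bigr => i is_.
  rewrite -sumrB [X in _ * cone_mvol _ _ X]/= cone_mvol_cons mulr_sumr.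
  apply: eq_bigr => j ij; rewrite -map_comp -/(N i j) [schur_val _ _ _ _]/schur_val.
  by ring.
rewrite !E; congr (_ - _); last first.
  by apply: eq_bigr => i _; apply: eq_bigr => j _; rewrite [z i * _]mulrC.
rewrite (exchange_big_dep [in s])/= => [|i j is_]; last by rewrite inE => /andP[].
apply: eq_bigr => j js; apply: eq_big => [i|i /andP[is_]].
  by rewrite !inE js eq_sym andbT andbC.
rewrite !inE => /andP[ji _]; rewrite [z i * _]mulrC NC// eq_sym//.
Qed.

Lemma cone_mvol_cat_cons g s zs z zs' : pos_def g s ->
  cone_mvol g s (zs ++ z :: zs') = cone_mvol g s (z :: zs ++ zs').
Proof.
move: {2}(size zs) (erefl (size zs)) => n.
elim: n => [|n IH] in g s zs z zs' *; case: zs => // u zs [szs] gs.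
rewrite [RHS]cone_mvol_swap// !cat_cons !cone_mvol_cons.
apply: eq_bigr => i is_; congr (_ * _).
by rewrite !map_cat !map_cons map_cat IH ?size_map//; apply: pd_schur.
Qed.

Lemma cone_mvol_perm (J : eqType) g s (f : J -> I -> R) js js' : pos_def g s ->
  perm_eq js js' -> cone_mvol g s (map f js) = cone_mvol g s (map f js').
Proof.
elim: js js' g s f => [|j js IH] js' g s f gs; first by rewrite perm_sym => /perm_nilP->.
move=> p; have : j \in js' by rewrite -(perm_mem p) mem_head.
move=> /splitPr jj; case: jj p => l1 l2.
rewrite perm_sym -cat1s perm_catCA cat1s perm_cons perm_sym => p.
rewrite map_cat/= cone_mvol_cat_cons// !cone_mvol_cons.
apply: eq_bigr => i is_; congr (_ * _).
by rewrite -map_cat -!map_comp (IH (l1 ++ l2))//; apply: pd_schur.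
Qed.

Lemma cone_mvolD g s zs (x y : I -> R) zs' : cone_mvol g s (zs ++ (x \+ y) :: zs') =
  cone_mvol g s (zs ++ x :: zs') + cone_mvol g s (zs ++ y :: zs').
Proof.
move: {2}(size zs) (erefl (size zs)) => n.
elim: n => [|n IH] in g s zs x y zs' *; case: zs => [|u zs] // szs.
  by rewrite !cone_mvol_cons -big_split; apply: eq_bigr => i _; rewrite /= mulrDl.
rewrite !cat_cons !cone_mvol_cons -big_split; apply: eq_bigr => i _.
rewrite [RHS]/= -mulrDr; congr (_ * _).
case: szs => szs; rewrite !map_cat/= -IH ?size_map//; congr (cone_mvol _ _ (_ ++ _ :: _)).
by apply/funext => k; rewrite [RHS]/= -schur_valD.
Qed.

Lemma cone_mvolZ g s c n z :
  cone_mvol g s (nseq n (fun i => c * z i)) = c ^+ n * cone_mvol g s (nseq n z).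
Proof.
elim: n g s z => [|n IH] g s z; first by rewrite expr0 mul1r.
rewrite /= !cone_mvol_cons mulr_sumr; apply: eq_bigr => i _; rewrite !map_nseq exprS.
have -> : schur_val g i (fun i => c * z i) = (fun k => c * schur_val g i z k).
  by apply/funext => k; rewrite schur_valZ.
by rewrite IH; ring.
Qed.

End ConeMixedVolume.

(** * Polarization of symmetric multiadditive functionals *)

Section Polarization.
Context {R : realType} {T : nmodType} (C : T -> Prop).
Hypotheses (C0 : C 0) (CD : forall x y, C x -> C y -> C (x + y)).

Definition set_arg n (z : 'I_n -> T) (k : 'I_n) (x : T) : 'I_n -> T :=
  fun l => if l == k then x else z l.

(** The domain [C] stands for the pseudocubical values, which are closed under sums but not under
    negation, so additivity is asked on [C] only. *)
Definition multiadditive n (Phi : ('I_n -> T) -> R) :=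
  forall z k x y, (forall l, C (z l)) -> C x -> C y ->
  Phi (set_arg z k (x + y)) = Phi (set_arg z k x) + Phi (set_arg z k y).

Lemma closed_sum (J : finType) (S : {pred J}) (u : J -> T) :
  (forall j, C (u j)) -> C (\sum_(j in S) u j).
Proof. by move=> Cu; apply: big_ind. Qed.

Lemma multiadditive_sum n (Phi : ('I_n -> T) -> R) z k (J : finType)
    (S : {pred J}) (u : J -> T) :
  multiadditive Phi -> (forall l, C (z l)) -> (forall j, C (u j)) ->
  Phi (set_arg z k (\sum_(j in S) u j)) = \sum_(j in S) Phi (set_arg z k (u j)).
Proof.
move=> PhiD Cz Cu.
suff : C (\sum_(j in S) u j) /\ Phi (set_arg z k (\sum_(j in S) u j)) =
  \sum_(j in S) Phi (set_arg z k (u j)) by case.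
elim/big_rec2 : _ => [|j y1 y2 _ [Cy1 <-]]; last by split; [exact: CD|exact: PhiD].
(* Cancelling in the expansion at [0 + 0] shows that the empty sum has value 0. *)
split=> //; have /eqP := PhiD z k 0 0 Cz C0 C0.
by rewrite addr0 -[X in X == _]addr0 (inj_eq (addrI _)) eq_sym => /eqP.
Qed.

Definition cons_arg n (x : T) (z : 'I_n -> T) : 'I_n.+1 -> T :=
  fun k => oapp z x (unlift ord0 k).

Lemma multiadditive_cons n (Phi : ('I_n.+1 -> T) -> R) x : multiadditive Phi ->
  C x -> multiadditive (fun z => Phi (cons_arg x z)).
Proof.
move=> PhiD Cx z k y y' Cz Cy Cy'.
have E u : cons_arg x (set_arg z k u) = set_arg (cons_arg x z) (lift ord0 k) u.
  apply/funext => l; rewrite /cons_arg /set_arg; case: unliftP => [l'|] ->.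
    by rewrite (inj_eq (@lift_inj _ _)).
  by rewrite (negPf (neq_lift _ _)).
by rewrite !E PhiD// => l; rewrite /cons_arg; case: unlift.
Qed.

Lemma multiadditive_expand (J : finType) n (Phi : ('I_n -> T) -> R) (u : J -> T)
    (S : {set J}) : multiadditive Phi -> (forall j, C (u j)) ->
  Phi (fun=> \sum_(j in S) u j) =
    \sum_(f : {ffun 'I_n -> J} | f \in ffun_on S) Phi (u \o f).
Proof.
elim: n => [|n IH] in Phi *; move=> PhiD Cu.
  pose f0 : {ffun 'I_0 -> J} := finfun_of_tuple [tuple].
  rewrite (big_pred1 f0) => [|f /=]; first by congr Phi; apply/funext => -[].
  by apply/ffun_onP/eqP => [_|_ []//]; apply/ffunP => -[].
have Cs := closed_sum S Cu.
pose c := cons_arg (\sum_(j in S) u j) (fun _ : 'I_n => \sum_(j in S) u j).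
have -> : (fun=> \sum_(j in S) u j) = set_arg c ord0 (\sum_(j in S) u j).
  by apply/funext => k; rewrite /set_arg /c /cons_arg; case: eqP => // _; case: unlift.
rewrite multiadditive_sum//; last first.
  by move=> l; rewrite /c /cons_arg; case: unlift.
pose h (p : J * {ffun 'I_n -> J}) : {ffun 'I_n.+1 -> J} :=
  [ffun k => oapp p.2 p.1 (unlift ord0 k)].
rewrite (reindex h)/=; last first.
  exists (fun f => (f ord0, [ffun k => f (lift ord0 k)])).
    move=> [j f] _; congr pair; first by rewrite ffunE unlift_none.
    by apply/ffunP => k; rewrite !ffunE liftK.
  by move=> f _; apply/ffunP => k; rewrite !ffunE; case: unliftP => [l|] -> /=; rewrite ?ffunE.
rewrite (eq_bigl (fun p : J * {ffun 'I_n -> J} =>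
    (p.1 \in S) && (p.2 \in ffun_on S))); last first.
  move=> [j f] /=; apply/ffun_onP/andP => [H|[jS /ffun_onP H] k].
    split; first by have := H ord0; rewrite ffunE unlift_none.
    by apply/ffun_onP => k; have := H (lift ord0 k); rewrite ffunE liftK.
  by rewrite ffunE; case: unliftP => [l|] _ /=.
rewrite -(pair_big [in S] [pred f | f \in ffun_on S] (fun j f => Phi (u \o h (j, f))))/=.
apply: eq_bigr => j jS.
have -> : set_arg c ord0 (u j) = cons_arg (u j) (fun=> \sum_(j in S) u j).
  apply/funext => k; rewrite /set_arg /c /cons_arg.
  by case: unliftP => [l|] -> //=; rewrite eq_sym (negPf (neq_lift _ _)).
rewrite (IH (fun z => Phi (cons_arg (u j) z)))//; last exact: multiadditive_cons.
apply: eq_bigr => f _; congr Phi; apply/funext => k.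
by rewrite /cons_arg /= ffunE; case: unliftP.
Qed.

(** Inclusion-exclusion: after expansion into maps [f] from the slots to [S], the signed sum over
    [S] keeps only the surjective [f]. These are the n! permutations, and each contributes [Phi z]
    by symmetry. *)
Lemma polarization_identity n (Phi : ('I_n -> T) -> R) (z : 'I_n -> T) :
  multiadditive Phi ->
  (forall z (pi : {perm 'I_n}), (forall k, C (z k)) -> Phi (z \o pi) = Phi z) ->
  (forall k, C (z k)) ->
  \sum_(S : {set 'I_n}) (-1) ^+ (n - #|S|) * Phi (fun=> \sum_(k in S) z k) =
  n`!%:R * Phi z.
Proof.
move=> PhiD PhiC Cz.
pose c (f : {ffun 'I_n -> 'I_n}) (k : 'I_n) : R := (k \notin codom f)%:R.
(* The sign times the condition that [f] lands in [S] is a product over [i]: a missing [i] costs -1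
   if [f] avoids it and 0 if [f] hits it. The sum over [S] then distributes into the product of the
   [1 - c f i]. *)
have cE (f : {ffun 'I_n -> 'I_n}) (S : {set 'I_n}) :
    (-1) ^+ (n - #|S|) * (f \in ffun_on S)%:R =
    \prod_i (if i \in S then 1 else - c f i).
  rewrite (bigID [in S])/= big1 ?mul1r => [|i ->//].
  rewrite (eq_bigr (fun i => -1 * c f i)) => [|i /negPf ->]; last by rewrite mulN1r.
  rewrite big_split/= prodr_const; congr (_ ^+ _ * _).
    transitivity #|~: S|; first by rewrite -(addKn #|S| #|~: S|) cardsC card_ord.
    by apply: eq_card => i; rewrite !inE.
  have [/ffun_onP fS|/ffun_onP fS] := boolP (f \in ffun_on S).
    rewrite big1// => i iS; rewrite /c (_ : i \in codom f = false)//.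
    by apply/negbTE; apply: contra iS => /codomP[k ->].
  have [k kS] : exists k, f k \notin S.
    by apply/existsP; apply: contra_notT fS => /existsPn H k; have := H k; rewrite negbK.
  by rewrite (bigD1 (f k))//= /c codom_f mul0r.
rewrite (eq_bigr (fun S : {set 'I_n} => \sum_(f : {ffun 'I_n -> 'I_n})
    Phi (z \o f) * \prod_i (if i \in S then 1 else - c f i))); last first.
  move=> S _; rewrite multiadditive_expand// mulr_sumr big_mkcond/=.
  apply: eq_bigr => f _; rewrite -cE.
  by case: (f \in _); rewrite ?mulr1 ?mulr0// mulrC.
rewrite exchange_big/=.
rewrite (eq_bigr (fun f : {ffun 'I_n -> 'I_n} =>
    Phi (z \o f) * \prod_i (i \in codom f)%:R)); last first.
  move=> f _; rewrite -mulr_sumr; congr (_ * _).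
  rewrite -(bigA_distr _ _ (fun=> 1) (fun i => - c f i)); apply: eq_bigr => i _.
  by rewrite [LHS](_ : _ = 1 - c f i)// /c; case: (i \in codom f); rewrite ?subr0 ?subrr.
rewrite (bigID (fun f : {ffun 'I_n -> 'I_n} => injectiveb f))/= addrC.
rewrite big1 ?add0r => [|f Uf]; last first.
  (* A self-map of a finite set that is not injective misses some [i], whose factor is 0. *)
  have [i iS] : exists i, i \notin codom f.
    apply/existsP; apply: contraNT Uf => /existsPn H.
    apply/injectiveP/injectiveP.
    rewrite /injectiveb /dinjectiveb (eq_uniq (s2 := enum 'I_n)) ?enum_uniq//.
      by rewrite size_map.
    by move=> i; rewrite mem_enum; have := H i; rewrite negbK.
  by rewrite (bigD1 i)//= (negPf iS) mul0r mulr0.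
rewrite (reindex (@pval _))/=; last first.
  pose in_Sn := insubd (1%g : 'S_n).
  by exists in_Sn => /= f Uf; first apply: val_inj; apply: insubdK.
transitivity (\sum_(pi : 'S_n) Phi z); last by rewrite sumr_const card_Sn mulr_natl.
apply: eq_big => [pi|pi _]; first by rewrite (valP pi).
rewrite big1 ?mulr1 => [|i _].
  by rewrite -(PhiC z pi)//; congr Phi; apply/funext => k; rewrite /= pvalE.
by rewrite -[i](permKV pi) -pvalE codom_f.
Qed.
End Polarization.

From mathcomp Require Import classical_sets functions ereal.
From mathcomp Require Import normedtype derive measurable_realfun.
From mathcomp Require Import measure numfun lebesgue_measure lebesgue_integral ftc.
Import numFieldNormedType.Exports.
Local Open Scope classical_set_scope.
Local Open Scope ring_scope.

(** * Iterated Lebesgue integration *)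

Section LebesgueTranslation.
Context {R : realType}.
Local Notation mu := (@lebesgue_measure R).

Lemma measurable_add_cst (b : R) :
  measurable_fun [set: measurableTypeR R]
    (fun x : measurableTypeR R => (x + b : measurableTypeR R)).
Proof. exact: (measurable_funD (f := id) (g := cst b)). Qed.

Lemma lebesgue_measure_translation (b : R) (A : set R) : measurable A ->
  pushforward mu (fun x : measurableTypeR R => (x + b : measurableTypeR R)) A = mu A.
Proof.
move=> mA; apply/esym/lebesgue_measure_unique => //=.
  exact: measurable_add_cst.
move=> mf _ [[u v]] _ <-.
rewrite /= /pushforward (_ : _ @^-1` _ = `]u - b, v - b]%classic); last first.
  by apply/seteqP; split=> x /=; rewrite !in_itv/= ltrBlDr lerBrDr.
rewrite !lebesgue_measure_itv/= !lte_fin ltrD2r; case: ifP => // _.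
by rewrite -!EFinB; congr EFin; ring.
Qed.

Lemma integral_translation (b : R) (f : R -> \bar R) :
  measurable_fun setT f -> (forall x, 0 <= f x)%E ->
  (\int[mu]_x f (x + b)%R = \int[mu]_x f x)%E.
Proof.
move=> mf f0.
pose h := fun x : measurableTypeR R => (x + b : measurableTypeR R).
have mh : measurable_fun setT h by exact: measurable_add_cst.
rewrite -[LHS](@ge0_integral_pushforward _ _ _ _ _ h mh mu setT f)//.
apply: eq_measure_integral => A mA _; exact: lebesgue_measure_translation.
Qed.

Lemma integral_deriv_horner (p : {poly R}) (c : R) : 0 <= c -> 
 (\int[mu]_(x in `[0%R, c]) (p^`()%R.[x])%:E = (p.[c] - p.[0])%:E)%E.
Proof.
rewrite le_eqVlt => /predU1P[<-|c0].
  by rewrite set_itv1 integral_set1 subrr.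
rewrite (@continuous_FTC2 _ _ (horner p))//.
- apply: continuous_subspaceT => x; exact: continuous_horner.
- split=> [x _||].
  + exact: derivable_horner.
  + apply: cvg_at_right_filter; exact: continuous_horner.
  + apply: cvg_at_left_filter; exact: continuous_horner.
- by move=> x _; rewrite -derivE.
Qed.
Lemma integral_expn (m : nat) (c : R) : 0 <= c ->
  (\int[mu]_(x in `[0%R, c]) (x ^+ m)%:E = (c ^+ m.+1 / m.+1%:R)%:E)%E.
Proof.
move=> c0; pose p : {poly R} := m.+1%:R^-1 *: 'X^(m.+1).
have dp x : p^`().[x] = x ^+ m.
  by rewrite derivZ derivXn hornerZ hornerMn hornerXn -[X in _ * X]mulr_natl mulKf ?pnatr_eq0.
under eq_integral do rewrite -dp.
by rewrite integral_deriv_horner// !hornerE expr0n mulr0 subr0 mulrC.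
Qed.

Lemma integral_expn_sub (m : nat) (c : R) : 0 <= c ->
  (\int[mu]_(x in `[0%R, c]) ((c - x) ^+ m)%:E = (c ^+ m.+1 / m.+1%:R)%:E)%E.
Proof.
move=> c0; pose p : {poly R} := - m.+1%:R^-1 *: (c%:P - 'X) ^+ m.+1.
have dp x : p^`().[x] = (c - x) ^+ m.
  rewrite derivZ deriv_exp derivB derivC derivX !hornerE hornerMn !hornerE.
  by rewrite -mulr_natr; field.
under eq_integral do rewrite -dp.
by rewrite integral_deriv_horner// !hornerE subrr expr0n mulr0 sub0r subr0 mulNr opprK mulrC.
Qed.

(** The interval is open at 0 because the pyramids exclude their apex. *)
Lemma integral_expn_itv (m : nat) (c k : R) : 0 <= c -> 0 <= k ->
  (\int[mu]_x (if x \in `]0%R, c] then (x ^+ m * k)%:E else 0) =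
   (c ^+ m.+1 / m.+1%:R * k)%:E)%E.
Proof.
move=> c0 k0; pose f (x : R) : \bar R := ((x ^+ m)%:E * k%:E)%E.
have mf D : measurable_fun D (fun x : R => (x ^+ m)%:E).
  by apply/measurable_EFinP; apply: measurable_funTS; exact: exprn_measurable.
transitivity (\int[mu]_x (f \_ `]0%R, c]%classic) x)%E.
  by apply: eq_integral => x _; rewrite patchE mem_setE EFinM.
rewrite -integral_mkcond integral_itv_obnd_cbnd; last exact: emeasurable_funM.
rewrite ge0_integralZr//; last first.
  by move=> x /=; rewrite in_itv/= => /andP[x0 _]; rewrite lee_fin exprn_ge0.
  exact: mf.
by rewrite integral_expn.
Qed.

Lemma integral_expn_sub_itv (m : nat) (c k : R) : 0 <= c -> 0 <= k ->
  (\int[mu]_x (if x \in `[0%R, c] then ((c - x) ^+ m * k)%:E else 0) =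
   (c ^+ m.+1 / m.+1%:R * k)%:E)%E.
Proof.
move=> c0 k0; pose f (x : R) : \bar R := (((c - x) ^+ m)%:E * k%:E)%E.
have mf D : measurable_fun D (fun x : R => ((c - x) ^+ m)%:E).
  apply/measurable_EFinP; apply: measurable_funTS.
  apply: measurable_funX; exact: measurable_funB.
transitivity (\int[mu]_x (f \_ `[0%R, c]%classic) x)%E.
  by apply: eq_integral => x _; rewrite patchE mem_setE EFinM.
rewrite -integral_mkcond ge0_integralZr//; last first.
  by move=> x /=; rewrite in_itv/= => /andP[_ xc]; rewrite lee_fin exprn_ge0 ?subr_ge0.
  exact: mf.
by rewrite integral_expn_sub.
Qed.

Lemma integral_support1 (f : R -> \bar R) : measurable_fun setT f ->
  (forall x x', f x != 0%E -> f x' != 0%E -> x = x') -> (\int[mu]_x f x = 0)%E.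
Proof.
move=> mf f1; have [[a fa]|f0] := pselect (exists a, f a != 0%E); last first.
  rewrite integral0_eq// => x _; apply/eqP/negPn/negP => fx; apply: f0; by exists x.
have mTa : measurable ([set: R] `\ a) by exact: measurableD.
rewrite -(integral_setD1 mTa); last exact: measurable_funS mf.
rewrite integral0_eq// => x [_ xa]; apply/eqP/negPn/negP => fx.
by apply: xa; apply: f1.
Qed.

End LebesgueTranslation.

(** * Iterated integrals over labelled coordinates *)

Section IteratedLebesgue.
Context {R : realType} {I : finType}.
Implicit Types (A B : set (I -> R)) (y : I -> R) (l : seq I).
Local Notation mu := (@lebesgue_measure R).

Definition upd y (i : I) (x : R) : I -> R := fun k => if k == i then x else y k.

(** The coordinates in [l] are integrated and the others are frozen at [y]. Naming coordinates by
    labels rather than positions makes passing to the star at [j] the removal of [j] from [l]. *)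
Fixpoint ileb l A y : \bar R :=
  if l is i :: l' then (\int[mu]_x ileb l' A (upd y i x))%E else (\1_A y)%:E.

(* Measurability for the product sigma-algebra on [I -> R], tested along
   coordinatewise measurable maps so that it passes to the slices in [ileb]. *)
Definition coord_measurable A := forall d (T : measurableType d)
  (f : T -> I -> R), (forall i, measurable_fun setT (f^~ i)) -> measurable (f @^-1` A).

Lemma coord_measurableI A B :
  coord_measurable A -> coord_measurable B -> coord_measurable (A `&` B).
Proof.
by move=> mA mB d T f mf; rewrite preimage_setI; apply: measurableI; [exact: mA|exact: mB].
Qed.

Lemma coord_measurableC A : coord_measurable A -> coord_measurable (~` A).
Proof. by move=> mA d T f mf; rewrite preimage_setC; apply/measurableC/mA. Qed.

Lemma coord_measurableD A B :
  coord_measurable A -> coord_measurable B -> coord_measurable (A `\` B).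
Proof. by move=> mA mB; rewrite setDE; apply/coord_measurableI/coord_measurableC. Qed.

Lemma ileb_ge0 l A y : (0 <= ileb l A y)%E.
Proof.
elim: l y => [|i l IH] y /=; first by rewrite lee_fin indicE.
exact: integral_ge0.
Qed.

Lemma measurable_upd d (T : measurableType d) (f : T -> I -> R) (h : T -> R) i :
  (forall k, measurable_fun setT (f^~ k)) -> measurable_fun setT h ->
  forall k, measurable_fun setT (fun t => upd (f t) i (h t) k).
Proof. by move=> mf mh k; rewrite /upd; case: eqP. Qed.

Lemma measurable_ileb l A d (T : measurableType d) (f : T -> I -> R) :
  coord_measurable A -> (forall i, measurable_fun setT (f^~ i)) ->
  measurable_fun setT (fun t => ileb l A (f t)).
Proof.
elim: l d T f => [|i l IH] d T f mA mf /=.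
  apply/measurable_EFinP; rewrite (_ : (fun t => \1_A (f t)) = \1_(f @^-1` A)).
    exact/measurable_indic/mA.
  by apply/funext => t; rewrite !indicE; congr (nat_of_bool _)%:R; apply/idP/idP; rewrite !inE.
pose G (p : T * measurableTypeR R) := ileb l A (upd (f p.1) i p.2).
apply: (measurable_fun_fubini_tonelli_F G) => [|p]; last exact: ileb_ge0.
apply: (IH _ (T * measurableTypeR R)%type (fun p => upd (f p.1) i p.2)) => //.
apply: measurable_upd => [k|]; last exact: measurable_snd.
exact: (measurableT_comp (mf k)).
Qed.

Lemma measurable_ileb_upd l A y i : coord_measurable A ->
  measurable_fun setT (fun x : measurableTypeR R => ileb l A (upd y i x)).
Proof.
move=> mA; apply: (measurable_ileb _ (f := fun x : measurableTypeR R => upd y i x)) => //.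
exact: (measurable_upd _ (f := fun=> y)).
Qed.

Lemma eq_ileb l A B y : (forall y', (forall k, k \notin l -> y' k = y k) -> A y' <-> B y') ->
  ileb l A y = ileb l B y.
Proof.
elim: l y => [|i l IH] y AB /=.
  rewrite !indicE; congr (nat_of_bool _)%:R%:E.
  by apply/idP/idP; rewrite !inE AB.
apply: eq_integral => x _; apply: IH => y' yy'; apply: AB => k.
by rewrite inE negb_or => /andP[ki kl]; rewrite yy'// /upd (negPf ki).
Qed.

Lemma ileb_set0 l y : ileb l set0 y = 0%E.
Proof.
elim: l y => [|i l IH] y /=; first by rewrite indic0.
by rewrite integral0_eq.
Qed.

Lemma ileb_eq0 l A y : (forall y', (forall k, k \notin l -> y' k = y k) -> ~ A y') ->
  ileb l A y = 0%E.
Proof. by move=> A0; rewrite -(ileb_set0 l y); apply: eq_ileb => y' /A0. Qed.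

Lemma ileb_splitI l A B y : coord_measurable A -> coord_measurable B ->
  ileb l A y = (ileb l (A `&` B) y + ileb l (A `\` B) y)%E.
Proof.
move=> mA mB; elim: l y => [|i l IH] y /=.
  rewrite -EFinD; congr EFin; rewrite !indicE in_setI in_setD.
  by case: (_ \in A) (_ \in B) => [] []; rewrite ?addr0 ?add0r.
transitivity (\int[mu]_x (ileb l (A `&` B) (upd y i x) + ileb l (A `\` B) (upd y i x)))%E.
  by apply: eq_integral => x _; exact: IH.
rewrite ge0_integralD//.
- by move=> x _; exact: ileb_ge0.
- by apply: measurable_ileb_upd; exact: coord_measurableI.
- by move=> x _; exact: ileb_ge0.
- by apply: measurable_ileb_upd; exact: coord_measurableD.
Qed.

Lemma ileb_swap i j l A y : coord_measurable A -> i != j ->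
  ileb [:: i, j & l] A y = ileb [:: j, i & l] A y.
Proof.
move=> mA ij /=.
pose G (p : measurableTypeR R * measurableTypeR R) := ileb l A (upd (upd y i p.1) j p.2).
transitivity (\int[mu]_x2 \int[mu]_x1 G (x1, x2))%E.
  apply: (fubini_tonelli G) => [|p]; last exact: ileb_ge0.
  apply: (measurable_ileb _ (f := fun p : measurableTypeR R * measurableTypeR R =>
    upd (upd y i p.1) j p.2)) => //.
  apply: measurable_upd; last exact: measurable_snd.
  apply: (measurable_upd _ (f := fun=> y)) => //; exact: measurable_fst.
apply: eq_integral => x2 _; apply: eq_integral => x1 _; rewrite /G /=; congr ileb.
apply/funext => k; rewrite /upd; case: (eqVneq k j) => // ->.
by rewrite eq_sym (negPf ij).
Qed.

Lemma ileb_cat_cons i l1 l2 A y : coord_measurable A -> i \notin l1 ->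
  ileb (l1 ++ i :: l2) A y = ileb (i :: l1 ++ l2) A y.
Proof.
move=> mA; elim: l1 y => [//|j l1 IH] y; rewrite inE negb_or => /andP[ij il1].
rewrite [RHS]ileb_swap//=; apply: eq_integral => x _; exact: IH.
Qed.

Lemma ileb_perm l l' A y : coord_measurable A -> uniq l -> perm_eq l l' ->
  ileb l A y = ileb l' A y.
Proof.
move=> mA; elim: l l' y => [|i l IH] l' y /=; first by rewrite perm_sym => _ /perm_nilP->.
move=> /andP[il ul] p; have ul' : uniq l' by rewrite -(perm_uniq p)/= il.
have : i \in l' by rewrite -(perm_mem p) mem_head.
move=> /splitPr jj; case: jj p ul' => l1 l2.
rewrite perm_sym -cat1s perm_catCA cat1s perm_cons perm_sym => p.
rewrite cat_uniq => /and3P[_ il1 _]; rewrite ileb_cat_cons//; last first.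
  by apply: contra il1 => il1; apply/hasP; exists i => //; rewrite mem_head.
apply: eq_integral => x _; exact: IH.
Qed.

Lemma ileb_translation l A b y : coord_measurable A ->
  ileb l [set y' | A (fun k => y' k + b k)] y = ileb l A (fun k => y k + b k).
Proof.
move=> mA; elim: l y => [|i l IH] y /=.
  by rewrite !indicE; congr (nat_of_bool _)%:R%:E.
rewrite -[RHS](integral_translation (b i)).
- apply: eq_integral => x _; rewrite IH; congr ileb; apply/funext => k.
  by rewrite /upd; case: eqP => // ->.
- exact: measurable_ileb_upd.
- by move=> x; exact: ileb_ge0.
Qed.

(** A graph over the other coordinates is null: once [k] is moved to the innermost integral, every
    slice has at most one point. *)
Lemma ileb_graph k l A y : coord_measurable A -> uniq l -> k \in l ->
  (forall y1 y2, A y1 -> A y2 -> (forall i, i != k -> y1 i = y2 i) -> y1 k = y2 k) ->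
  ileb l A y = 0%E.
Proof.
move=> mA ul kl Ak.
rewrite (ileb_perm y mA ul (l' := rem k l ++ [:: k])); last first.
  by rewrite cats1 perm_sym perm_rcons perm_sym perm_to_rem.
elim: (rem k l) y => [|i l' IH] y /=; last by apply: integral0_eq => x _; exact: IH.
apply: integral_support1 => [|x x'].
  exact: (@measurable_ileb_upd [::]).
have A1 u : (\1_A (upd y k u))%:E != 0%E -> A (upd y k u).
  by rewrite indicE; case: (boolP (_ \in A)); rewrite ?eqxx// => /set_mem.
move=> /A1 Ax /A1 Ax'; have := Ak _ _ Ax Ax'; rewrite /upd eqxx; apply.
by move=> j /negPf->.
Qed.

Lemma le_ileb l A B y : coord_measurable A -> coord_measurable B -> A `<=` B ->
  (ileb l A y <= ileb l B y)%E.
Proof.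
move=> mA mB AB; rewrite (ileb_splitI l y mB mA) ((setIidPr B A).2 AB).
by rewrite leeDl// ileb_ge0.
Qed.

Lemma ileb_subset0 l A B y : coord_measurable A -> coord_measurable B -> A `<=` B ->
  ileb l B y = 0%E -> ileb l A y = 0%E.
Proof.
move=> mA mB AB B0; apply/eqP; rewrite eq_le ileb_ge0 andbT -B0.
exact: le_ileb.
Qed.

Lemma coord_measurable_forall (J : finType) (S : {pred J}) (B : J -> set (I -> R)) :
  (forall i, i \in S -> coord_measurable (B i)) ->
  coord_measurable [set y | forall i, i \in S -> B i y].
Proof.
move=> mB d T f mf.
rewrite (_ : _ @^-1` _ = \bigcap_(i in [set i | i \in S]) (f @^-1` B i)); last first.
  by apply/seteqP; split=> t /= tB i /= iS; apply: tB.
apply: fin_bigcap_measurable => [|i iS]; first exact: cardinality.finite_finset.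
exact: mB.
Qed.

(** Additivity for pieces that overlap in null sets and cover up to a null set. Cutting [B j] out of
    [A] changes each remaining piece only by a null overlap. *)
Lemma ileb_partition (J : eqType) l A (B : J -> set (I -> R)) (js : seq J) y :
  coord_measurable A -> (forall j, coord_measurable (B j)) -> uniq js ->
  (forall j k, j \in js -> k \in js -> j != k -> ileb l (A `&` (B j `&` B k)) y = 0%E) ->
  (ileb l (A `&` [set y | forall j, j \in js -> ~ B j y]) y = 0)%E ->
  ileb l A y = (\sum_(j <- js) ileb l (A `&` B j) y)%E.
Proof.
elim: js A => [|j js IH] A mA mB ujs AB0 A0.
  rewrite big_nil -A0; congr (ileb _ _ _); apply/seteqP; split=> x; last by case.
  by move=> Ax; split=> // j; rewrite in_nil.
move: ujs; rewrite cons_uniq => /andP[jjs ujs].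
rewrite big_cons (ileb_splitI l y mA (mB j)); congr (_ + _)%E.
have mAj := coord_measurableD mA (mB j).
rewrite IH//.
- apply: eq_big_seq => k kjs.
  rewrite [RHS](ileb_splitI l y (coord_measurableI mA (mB k)) (mB j)).
  rewrite -setIA AB0 ?inE ?eqxx ?kjs ?orbT//; last by apply: contraNneq jjs => <-.
  by rewrite add0e !setDE setIAC.
- move=> k k' kjs kjs' kk'.
  apply: ileb_subset0 (AB0 k k' _ _ kk'); rewrite ?inE ?kjs ?kjs' ?orbT//.
  + by apply: coord_measurableI => //; exact: coord_measurableI.
  + by apply: coord_measurableI => //; exact: coord_measurableI.
  + by apply: setSI; exact: subDsetl.
- rewrite -A0; congr (ileb _ _ _); rewrite setDE -setIA; congr (_ `&` _).
  apply/seteqP; split=> x /=.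
    by move=> [xj xjs] k; rewrite inE => /predU1P[->//|]; exact: xjs.
  move=> xjs; split=> [|k kjs]; first by apply: xjs; rewrite mem_head.
  by apply: xjs; rewrite inE kjs orbT.
Qed.

Definition coord_measurable_fun (F : (I -> R) -> R) := forall d (T : measurableType d)
  (f : T -> I -> R), (forall i, measurable_fun setT (f^~ i)) ->
  measurable_fun setT (fun t => F (f t)).

Lemma coord_measurable_le F G : coord_measurable_fun F -> coord_measurable_fun G ->
  coord_measurable [set y | F y <= G y].
Proof.
move=> mF mG d T f mf.
have mFG := measurable_fun_ler (mF _ _ _ mf) (mG _ _ _ mf).
by have := mFG measurableT [set true] Logic.I; rewrite setTI.
Qed.

Lemma coord_measurable_lt F G : coord_measurable_fun F -> coord_measurable_fun G ->
  coord_measurable [set y | F y < G y].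
Proof.
move=> mF mG; rewrite (_ : mkset _ = ~` [set y | G y <= F y]).
  exact/coord_measurableC/coord_measurable_le.
by apply/seteqP; split=> y /=; [move=> FG; rewrite leNgt FG|move/negP; rewrite -ltNge].
Qed.

Lemma coord_measurable_cst c : coord_measurable_fun (fun=> c).
Proof. by move=> d T f mf; exact: measurable_cst. Qed.

Lemma coord_measurable_proj k : coord_measurable_fun (fun y => y k).
Proof. by move=> d T f mf; exact: mf. Qed.

Lemma coord_measurable_mul F G : coord_measurable_fun F -> coord_measurable_fun G ->
  coord_measurable_fun (fun y => F y * G y).
Proof. by move=> mF mG d T f mf; apply: measurable_funM; [exact: mF|exact: mG]. Qed.

Lemma coord_measurable_sum (J : Type) (js : seq J) (P : pred J) (F : J -> (I -> R) -> R) :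
  (forall k, coord_measurable_fun (F k)) ->
  coord_measurable_fun (fun y => \sum_(k <- js | P k) F k y).
Proof.
move=> mF d T f mf.
under eq_fun do rewrite big_mkcond/=.
apply: measurable_sum => k; case: (P k) => //; exact: mF.
Qed.

Definition simplex l (c : R) : set (I -> R) :=
  [set y | (forall i, i \in l -> 0 <= y i) /\ \sum_(i <- l) y i <= c].

(** The slice [y i = x] is a simplex of size [c - x]. The case [c = 1] is the denominator of
    [cone_vol]. *)
Lemma ileb_simplex l c y : uniq l -> 0 <= c ->
  ileb l (simplex l c) y = (c ^+ size l / (size l)`!%:R)%:E.
Proof.
elim: l c y => [|i l IH] c y /=.
  move=> _ c0; rewrite expr0 fact0 divr1 indicE mem_set//.
  by split=> // ; rewrite big_nil.
move=> /andP[il ul] c0.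
have F x : ileb l (simplex (i :: l) c) (upd y i x) =
    if (x \in `[0, c]) then ((c - x) ^+ size l * (size l)`!%:R^-1)%:E else 0%E.
  rewrite in_itv/=; case: ifPn => [/andP[x0 xc]|xc].
    rewrite -(IH (c - x) (upd y i x))// ?subr_ge0//.
    apply: eq_ileb => y' yy'; have y'i : y' i = x by rewrite yy'// /upd eqxx.
    rewrite /simplex /= big_cons y'i lerBrDl; split=> -[y0 yc]; split=> // j.
      by move=> jl; apply: y0; rewrite inE jl orbT.
    by rewrite inE => /predU1P[->|]; [rewrite y'i|exact: y0].
  apply: ileb_eq0 => y' yy' [y0]; have y'i : y' i = x by rewrite yy'// /upd eqxx.
  rewrite big_cons y'i => yc; move/negP: xc; apply.
  rewrite -y'i y0 ?mem_head//= y'i (le_trans _ yc)// lerDl big_seq sumr_ge0// => j jl.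
  by rewrite y0// inE jl orbT.
under eq_integral do rewrite F.
by rewrite integral_expn_sub_itv ?invr_ge0// factS natrM invfM mulrA.
Qed.

End IteratedLebesgue.

(** * Volumes of truncated cones *)

Section TruncatedConeVolume.
Context {R : realType} {I : finType}.
Implicit Types (g : I -> I -> R) (s t : {set I}) (z a y : I -> R).
Local Notation mu := (@lebesgue_measure R).

Definition truncated g s z : set (I -> R) :=
  [set y | exists2 a, incone g s z a & forall k, k \in s -> y k = gram_app g s a k].

(** The points whose ray from 0 meets the facet [y j = z j] first: [y k / z k] is maximal at [j],
    with denominators cleared because values may vanish. *)
Definition pyramid s z j : set (I -> R) :=
  [set y | 0 < y j /\ forall k, k \in s -> y k * z j <= z k * y j].

Lemma truncated_measurable g s z : pos_def g s -> coord_measurable (truncated g s z).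
Proof.
(* The [h k] are the columns of the inverse Gram matrix. They turn the existential coefficients into
   linear functions [c i y], so that finitely many linear inequalities describe the truncation. *)
move=> gs; have /choice[h hE] k := gram_app_surj (fun m : I => (m == k)%:R) gs.
pose c i y := \sum_(k in s) h k i * y k.
have cE y m : m \in s -> gram_app g s (c^~ y) m = y m.
  move=> ms; rewrite /gram_app /c.
  under eq_bigr do rewrite mulr_sumr.
  rewrite exchange_big/= (bigD1 m)//= [X in _ + X]big1 => [|k /andP[ks km]].
    rewrite addr0; under eq_bigr do rewrite mulrA.
    by rewrite -mulr_suml -/(gram_app _ _ _ _) hE// eqxx mul1r.
  under eq_bigr do rewrite mulrA.
  by rewrite -mulr_suml -/(gram_app _ _ _ _) hE// eq_sym (negPf km) mul0r.
rewrite (_ : truncated g s z = [set y | forall i, i \in s -> 0 <= c i y] `&`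
    [set y | forall i, i \in s -> y i <= z i]).
  apply: coord_measurableI; apply: coord_measurable_forall => i _; apply: coord_measurable_le.
  - exact: coord_measurable_cst.
  - apply: coord_measurable_sum => k; apply: coord_measurable_mul.
      exact: coord_measurable_cst.
    exact: coord_measurable_proj.
  - exact: coord_measurable_proj.
  - exact: coord_measurable_cst.
apply/seteqP; split=> y.
  move=> [a [a0 az] ya]; split=> i is_; last by rewrite ya// az.
  suff -> : c i y = a i by exact: a0.
  have := pd_inj gs (a := c^~ y \+ (fun k => -1 * a k)).
  move=> /(_ _ i is_)/= => E; apply/eqP; rewrite -subr_eq0 -mulN1r E// => k ks.
  by rewrite gram_appD gram_appZ cE// mulN1r -ya// subrr.
move=> [c0 yz]; exists (c^~ y); last by move=> k ks; rewrite cE.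
by split=> [i is_|k ks]; [exact: c0|rewrite cE ?yz].
Qed.

Lemma pyramid_measurable s z j : coord_measurable (pyramid s z j).
Proof.
rewrite (_ : pyramid s z j = [set y | 0 < y j] `&` 
    [set y | forall k, k \in s -> y k * z j <= z k * y j]) //.
apply: coord_measurableI.
  by apply: coord_measurable_lt; [exact: coord_measurable_cst|exact: coord_measurable_proj].
apply: coord_measurable_forall => k _; apply: coord_measurable_le.
  by apply: coord_measurable_mul; [exact: coord_measurable_proj|exact: coord_measurable_cst].
by apply: coord_measurable_mul; [exact: coord_measurable_cst|exact: coord_measurable_proj].
Qed.

(* The slice [y j = x] of a pyramid is a translate of the truncation of the
   star at [j] by [x / z j] times the star values. *)
Lemma pyramid_slice g s z j x y : pos_def g s -> pscub g s z -> j \in s ->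
  0 < x <= z j -> y j = x ->
  (truncated g s z `&` pyramid s z j) y <->
  truncated (schur g j) (s :\ j) (fun k => x / z j * schur_val g j z k)
    (fun k => y k + - (g k j / g j j * x)).
Proof.
move=> gs zs js /andP[x0 xz] yj; have z0 i := pscub_ge0 gs zs (i := i).
have zj : 0 < z j by exact: lt_le_trans xz.
have gj := pd_diag_neq0 gs js; set c := x / z j.
have c0 : 0 <= c by rewrite divr_ge0// ltW.
have c1 : c <= 1 by rewrite ler_pdivrMr// mul1r.
have czj : c * z j = x by rewrite divfK// gt_eqF.
have -> : (fun k => c * schur_val g j z k) = schur_val g j (fun k => c * z k).
  by apply/funext => k; rewrite schur_valZ.
(* The pyramid inequalities put [y] on the facet [y j = c * z j] of the truncation at [c * z], which
   [incone_schur] and [incone_lift] identify with a truncation of the star. *)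
split=> [[[a az ya] [_ yC]]|[a az ya]].
  have aj : gram_app g s a j = c * z j by rewrite -ya// yj czj.
  have acz : incone g s (fun k => c * z k) a.
    split=> [|k ks]; first exact: az.1.
    by rewrite -ya// /c mulrAC ler_pdivlMr// [x * _]mulrC -yj yC.
  exists a; first exact: incone_schur.
  by move=> k; rewrite !inE => /andP[kj ks]; rewrite gram_app_schur// /schur_val aj czj ya.
have zcs : pscub g s (fun k => c * z k) by exact: pscubZ.
have := incone_lift gs zcs js az; set b := lift_coef _ _ _ _ _ => bcz.
have yb k : k \in s -> y k = gram_app g s b k.
  move=> ks; have [->|kj] := eqVneq k j; first by rewrite gram_app_lift// yj czj.
  by rewrite gram_app_lift_schur// -ya ?inE ?kj// czj subrK.
have ycz k : k \in s -> y k <= c * z k by move=> ks; rewrite yb// bcz.2.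
split; last first.
  split=> [|k ks]; first by rewrite yj.
  rewrite yj -[in leRHS]czj mulrA [z k * c]mulrC; apply: ler_wpM2r (ycz _ ks).
  exact: ltW.
exists b => //; split=> [|k ks]; first exact: bcz.1.
by rewrite -yb// (le_trans (ycz _ ks))// ler_piMl// z0.
Qed.

Lemma truncated_out_pyramid g s z y k : pos_def g s -> pscub g s z ->
  truncated g s z y -> (forall j, j \in s -> ~ pyramid s z j y) -> k \in s -> y k = 0.
Proof.
move=> gs zs [a az ya] yC ks.
have a0 : {in s, a =1 fun=> 0}.
  move=> i is_; apply/eqP/negPn/negP => ai.
  have [j js [yj jmax]] := incone_pyramid gs (fun i => pscub_ge0 gs zs (i := i)) az is_ ai.
  apply: (yC j js); split=> [|m ms]; first by rewrite ya.
  by rewrite !ya// jmax.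
by rewrite ya// (eq_gram_app g a0) /gram_app big1// => l _; rewrite mulr0.
Qed.

Lemma cone_mvol_ge0 g s n z : pos_def g s -> pscub g s z ->
  0 <= cone_mvol g s (nseq n z).
Proof.
elim: n g s z => [|n IH] g s z gs zs; first exact: ler01.
rewrite cone_mvol_cons sumr_ge0// => i is_; rewrite mulr_ge0 ?(pscub_ge0 gs zs)//.
by rewrite map_nseq IH//; [exact: pd_schur|exact: pscub_schur].
Qed.

(** The slice at height [x] of the pyramid over the facet [j] has volume [(x / z j) ^+ n] times
    [N j] / n!. Integrated over []0, z j]] this gives [z j * N j] / (n+1)!, the term of [j] in
    [cone_mvol]. *)
Lemma ileb_truncated n g s l z y : pos_def g s -> pscub g s z -> size l = n ->
  uniq l -> l =i s ->
  ileb l (truncated g s z) y = (cone_mvol g s (nseq n z) / n`!%:R)%:E.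
Proof.
elim: n => [|n IH] in g s l z y *; move=> gs zs sl ul ls.
  move/size0nil: sl ls => -> ls /=; rewrite fact0 divr1 indicE mem_set//.
  have s0 k : k \in s -> False by rewrite -ls in_nil.
  by exists (fun=> 0) => [|k /s0//]; split=> [i /s0|k /s0].
have z0 i := pscub_ge0 gs zs (i := i).
have mT := truncated_measurable z gs.
rewrite (ileb_partition (B := pyramid s z) (js := l))//; last first.
- have [k kl] : exists k, k \in l by case: l sl {ul ls} => // k l' _; exists k; rewrite mem_head.
  apply: (ileb_graph (k := k)) => //.
    apply: coord_measurableI => //; apply: coord_measurable_forall => j _.
    exact/coord_measurableC/pyramid_measurable.
  move=> y1 y2 [T1 C1] [T2 C2] _.
  rewrite (truncated_out_pyramid gs zs T1)//; last by rewrite -ls.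
    rewrite (truncated_out_pyramid gs zs T2)//; last by rewrite -ls.
    by move=> j; rewrite -ls; exact: C2.
  by move=> j; rewrite -ls; exact: C1.
- move=> j k jl kl jk; apply: (ileb_graph (k := k)) => //.
    by do 2 apply: coord_measurableI => //; exact: pyramid_measurable.
  (* On the overlap both ratios are maximal, so [y' k] is determined by [y' j]. *)
  have E y' : (truncated g s z `&` (pyramid s z j `&` pyramid s z k)) y' ->
      0 < z j /\ y' k * z j = z k * y' j.
    move=> [[a az ya] [[yj jC] [yk kC]]]; split.
      by rewrite (lt_le_trans yj)// ya ?az.2 -?ls.
    apply/eqP; rewrite eq_le jC -?ls//= mulrC [leRHS]mulrC kC -?ls//.
  move=> y1 y2 /E[zj e1] /E[_ e2] y12; apply: (mulIf (lt0r_neq0 zj)).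
  by rewrite e1 e2 y12.
- by move=> j; exact: pyramid_measurable.
pose N j := cone_mvol (schur g j) (s :\ j) (nseq n (schur_val g j z)).
transitivity (\sum_(j <- l) (z j * N j / n.+1`!%:R)%:E)%E; last first.
  rewrite sumEFin -mulr_suml cone_mvol_cons; congr (_ / _)%:E.
  rewrite (perm_big (enum s))/=; last first.
    by apply: uniq_perm => //; [exact: enum_uniq|move=> j; rewrite mem_enum ls].
  by rewrite big_enum/=; apply: eq_bigr => j _; rewrite map_nseq.
apply: eq_big_seq => j jl; have js : j \in s by rewrite -ls.
have N0 : 0 <= N j by apply: cone_mvol_ge0; [exact: pd_schur|exact: pscub_schur].
rewrite (ileb_perm y _ ul (perm_to_rem jl)); last first.
  by apply: coord_measurableI => //; exact: pyramid_measurable.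
transitivity (\int[mu]_x (if x \in `]0%R, z j]
    then (x ^+ n * (N j / z j ^+ n / n`!%:R))%:E else 0))%E; last first.
  rewrite integral_expn_itv ?z0//; last by rewrite !divr_ge0// exprn_ge0// z0.
  (* If [z j = 0], the pyramid is empty within the truncation and both sides vanish; only otherwise
     is [z j] cancelled. *)
  congr EFin; have [->|zj] := eqVneq (z j) 0; first by rewrite exprS !mul0r.
  rewrite factS natrM exprS.
  have : n.+1%:R != 0 :> R by rewrite pnatr_eq0.
  have : n`!%:R != 0 :> R by rewrite pnatr_eq0 -lt0n fact_gt0.
  have : z j ^+ n != 0 by rewrite expf_neq0.
  move: (z j ^+ n) n`!%:R n.+1%:R => u v w u0 v0 w0; field.
  by rewrite u0 v0 w0.
have jr : j \notin rem j l by rewrite mem_rem_uniq// inE eqxx.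
apply: eq_integral => x _; rewrite in_itv/=.
case: ifPn => [x0|x0]; last first.
  apply: ileb_eq0 => y' yy' [[a az ya] [yj _]]; move/negP: x0; apply.
  have y'j : y' j = x by rewrite yy'// /upd eqxx.
  by rewrite -y'j yj ya ?az.2.
pose A' := truncated (schur g j) (s :\ j) (fun k => x / z j * schur_val g j z k).
transitivity (ileb (rem j l) [set y' | A' (fun k => y' k + - (g k j / g j j * x))] (upd y j x)).
  apply: eq_ileb => y' yy'; apply: pyramid_slice => //.
  by rewrite yy'// /upd eqxx.
have gsj := pd_schur gs js; have zsj := pscub_schur gs js zs.
have [x_gt0 xz] := andP x0; have zj := lt_le_trans x_gt0 xz.
rewrite ileb_translation; last exact: truncated_measurable.
rewrite IH//.
- by rewrite cone_mvolZ -/(N j) expr_div_n; congr EFin; ring.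
- by apply: pscubZ => //; rewrite divr_ge0// ltW.
- by rewrite size_rem// sl.
- exact: rem_uniq.
- by move=> k; rewrite mem_rem_uniq// !inE ls.
Qed.
End TruncatedConeVolume.

(** * Cones of a marked fan *)

Section DotProduct.
Context {R : realType} {V : vectType R}.
Variable ip : {dot V for idfun}.
Implicit Types u v : V.

Lemma dotC u v : ip u v = ip v u.
Proof. by rewrite hermC expr0 mul1r. Qed.

Lemma dotZl c u v : ip (c *: u) v = c * ip u v.
Proof. exact: linearZl_LR. Qed.

Lemma dotBl u u' v : ip (u - u') v = ip u v - ip u' v.
Proof. exact: linearBl. Qed.

Lemma dotZr c u v : ip u (c *: v) = c * ip u v.
Proof. by rewrite dotC dotZl dotC. Qed.

Lemma dot_suml (J : Type) (js : seq J) (P : pred J) (a : J -> R) (u : J -> V) v :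
  ip (\sum_(j <- js | P j) a j *: u j) v = \sum_(j <- js | P j) a j * ip (u j) v.
Proof. by rewrite linear_sumlz; apply: eq_bigr => j _; exact: dotZl. Qed.

Lemma dot_eq0 u : ip u u = 0 -> u = 0.
Proof.
by move=> u0; apply/eqP; apply: contraT => /(neq0_dnorm_gt0 (s := ip)); rewrite u0 ltxx.
Qed.

Lemma dot_ge0 u : 0 <= ip u u.
Proof.
have [->|u0] := eqVneq u 0; first by rewrite linear0l.
exact/ltW/(neq0_dnorm_gt0 (s := ip)).
Qed.

Lemma dot_span0 (X : seq V) v : v \in <<X>>%VS -> {in X, forall x, ip v x = 0} -> v = 0.
Proof.
move=> vX v0; apply: dot_eq0.
have /subvP/(_ v vX) : (<<X>> <= orthov ip <[v]>)%VS.
  apply/span_subvP => x xX; apply/mem_orthovP => _ /vlineP[c ->].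
  by rewrite [LHS](dotZr c x v) dotC v0 ?mulr0.
by move/mem_orthovP; apply; exact: memv_line.
Qed.

End DotProduct.

Section FanCones.
Context {R : realType} {V : vectType R} {I : finType}.
Variables (ip : {dot V for idfun}) (F : marked_fan V I).
Implicit Types (s t : {set I}) (z a : I -> R) (v : V).

Definition gram i j := ip (mark F i) (mark F j).

Definition comb s a : V := \sum_(i in s) a i *: mark F i.

Definition independent s := forall a, comb s a = 0 -> {in s, forall i, a i = 0}.

Lemma comb_span s a : comb s a \in cone_span F s.
Proof.
by apply: memv_suml => i is_; rewrite memvZ// memv_span// map_f// mem_enum.
Qed.

Lemma independentP s : \dim (cone_span F s) = #|s| <-> independent s.
Proof.
have E : \dim (cone_span F s) = #|s| <-> free [seq mark F i | i <- enum s].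
  rewrite /free size_map -cardE; by split=> [->|/eqP].
have [->|[i0 i0s]] := set_0Vmem s.
  by split=> [_ a _ i|_]; [rewrite inE|rewrite /cone_span finset.enum_set0 span_nil dimv0 cards0].
rewrite E -[X in free X]in_tupleE.
have cE a : comb s a = \sum_(k < size [seq mark F i | i <- enum s])
    a (nth i0 (enum s) k) *: [seq mark F i | i <- enum s]`_k.
  rewrite /comb -big_enum/= (big_nth i0) big_mkord size_map.
  by apply: eq_bigr => k _; rewrite (nth_map i0).
split=> [/freeP H a|H]; last first.
  apply/freeP => k k0 m; pose a i := oapp k 0 (insub (index i (enum s))).
  have aE (j : 'I_(size [seq mark F i | i <- enum s])) : a (nth i0 (enum s) j) = k j.
    rewrite /a index_uniq ?enum_uniq ?valK//.
    by have := ltn_ord j; rewrite [X in (_ < X)%N]size_map.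
  rewrite -aE; apply: (H a); last first.
    rewrite -mem_enum mem_nth//; have := ltn_ord m; by rewrite [X in (_ < X)%N]size_map.
  by rewrite cE -[RHS]k0; apply: eq_bigr => j _; rewrite aE.
rewrite cE => /(H (fun k => a (nth i0 (enum s) k))) a0 i is_.
have ii : (index i (enum s) < size [seq mark F i | i <- enum s])%N.
  by rewrite size_map index_mem mem_enum.
by have := a0 (Ordinal ii); rewrite /= nth_index// mem_enum.
Qed.

Lemma gram_appE s a i : gram_app gram s a i = ip (comb s a) (mark F i).
Proof. by rewrite dot_suml; apply: eq_bigr => l _; rewrite mulrC /gram dotC. Qed.

Lemma gram_pd s : independent s -> pos_def gram s.
Proof.
move=> fs; split=> [i j|a [i is_ ai]]; first exact: dotC.
rewrite (eq_bigr (fun i => a i * ip (mark F i) (comb s a))) => [|j _]; last first.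
  by rewrite gram_appE dotC.
rewrite -dot_suml; apply: neq0_dnorm_gt0; apply: contra_neq ai => a0.
exact: fs a0 i is_.
Qed.

Lemma span_comb s v : independent s -> v \in cone_span F s ->
  exists2 a, v = comb s a & {in s, forall i, gram_app gram s a i = ip v (mark F i)}.
Proof.
move=> fs vs; have [a aE] := gram_app_surj (fun i => ip v (mark F i)) (gram_pd fs).
exists a => //; apply/eqP; rewrite -subr_eq0; apply/eqP.
apply: (@dot_span0 _ _ ip [seq mark F i | i <- enum s]).
  by rewrite memvB// comb_span.
move=> x /mapP[i]; rewrite mem_enum => is_ ->.
by rewrite dotBl -gram_appE aE// subrr.
Qed.

Lemma wvecP s z : independent s -> wvec ip F s z \in cone_span F s /\
  {in s, forall i, ip (wvec ip F s z) (mark F i) = z i}.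
Proof.
move=> fs; pose P := [set w | w \in cone_span F s /\
  forall i, i \in s -> ip w (mark F i) = z i].
suff /(xgetPex 0) : exists w, P w by [].
have [a aE] := gram_app_surj z (gram_pd fs); exists (comb s a); split.
  exact: comb_span.
by move=> i is_; rewrite -gram_appE aE.
Qed.

Lemma fan_coneP s v :
  fan_cone F s v <-> exists2 a, (forall i, i \in s -> 0 <= a i) & v = comb s a.
Proof.
split=> -[a a0 ->]; first by exists a.
exists (fun i => if i \in s then a i else 0) => [i|]; first by case: ifP => // /a0.
by apply: eq_bigr => i ->.
Qed.

Lemma truncationP s z v : truncation ip F s z v <->
  exists2 a, incone gram s z a & v = comb s a.
Proof.
split=> [[/fan_coneP[a a0 ->] az]|[a [a0 az] ->]].
  by exists a => //; split=> // i is_; rewrite gram_appE az.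
split; first by apply/fan_coneP; exists a.
by move=> i is_; rewrite -gram_appE az.
Qed.

Lemma independent_sub s t : t \subset s -> independent s -> independent t.
Proof.
move=> ts fs a a0 i it.
have := fs (fun i => if i \in t then a i else 0).
have -> : comb s (fun i => if i \in t then a i else 0) = comb t a.
  rewrite /comb (big_setID t)/= (finset.setIidPr ts) [X in _ + X]big1 ?addr0.
    by apply: eq_bigr => j ->.
  by move=> j; rewrite inE => /andP[/negPf -> _]; rewrite scale0r.
by move=> /(_ a0 i); rewrite it (fintype.subsetP ts)//; apply.
Qed.

Lemma pscub_pseudocubical s z : independent s ->
  (forall t, t \subset s -> t \in cones F) ->
  pseudocubical ip F z -> pscub gram s z.
Proof.
move=> fs cs zF t ts; have ft := independent_sub ts fs.
have /fan_coneP[a a0 wa] := zF _ (cs t ts).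
by exists a => // k kt; rewrite gram_appE -wa (wvecP z ft).2.
Qed.

End FanCones.

Section LebesgueTuple.
Context {R : realType} {I : finType}.

Definition tuple_val (l : seq I) (y0 : I -> R) n (y : n.-tuple R) : I -> R :=
  fun k => if k \in l then nth 0 y (index k l) else y0 k.

Lemma lebesgue_tuple_ileb n (l : seq I) (A : set (I -> R)) (y0 : I -> R) :
  size l = n -> uniq l ->
  @lebesgue_tuple R n [set y | A (tuple_val l y0 y)] = ileb l A y0.
Proof.
elim: n l y0 => [|n IH] [|i l] y0 //= sl ul.
case: sl => sl; move: ul => /andP[il ul].
apply: eq_integral => x _; rewrite -(IH _ _ sl ul); congr lebesgue_tuple.
apply/funext => y /=; congr A; apply/funext => k.
rewrite /tuple_val inE /upd; have [->|ki] /= := eqVneq k i.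
  by rewrite eqxx (negPf il).
by rewrite eq_sym (negPf ki).
Qed.
End LebesgueTuple.

Section ConeVolume.
Context {R : realType} {V : vectType R} {I : finType}.
Variables (ip : {dot V for idfun}) (F : marked_fan V I).
Implicit Types (s t : {set I}) (z a : I -> R) (v : V).

Lemma dot_dual s i j : independent F s -> i \in s -> j \in s ->
  ip (dual_mark ip F s i) (mark F j) = (j == i)%:R.
Proof. by move=> fs is_ js; rewrite (wvecP _ _ fs).2. Qed.

Lemma comb_dual s a : independent F s -> {in s, forall i,
  ip (\sum_(k in s) a k *: dual_mark ip F s k) (mark F i) = a i}.
Proof.
move=> fs i is_; rewrite dot_suml (bigD1 i)//= dot_dual// eqxx mulr1.
rewrite big1 ?addr0// => k /andP[ks ki].
by rewrite dot_dual// eq_sym (negPf ki) mulr0.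
Qed.

Lemma dual_span s a : independent F s ->
  \sum_(k in s) a k *: dual_mark ip F s k \in cone_span F s.
Proof.
by move=> fs; apply: memv_suml => i is_; rewrite memvZ//; exact: (wvecP _ _ fs).1.
Qed.

Definition set_coord s (y : #|s|.-tuple R) : I -> R := tuple_val (enum s) (fun=> 0) y.

Lemma dual_coordE s y :
  @dual_coord _ _ _ ip F s y = \sum_(k in s) set_coord y k *: dual_mark ip F s k.
Proof.
rewrite /dual_coord [RHS]big_enum_val/=; apply: eq_bigr => k _; congr (_ *: _).
rewrite /set_coord /tuple_val mem_enum enum_valP (tnth_nth 0); congr nth.
by rewrite /enum_val index_uniq ?enum_uniq// -cardE.
Qed.

(** The coordinates of a vector in the dual basis are its products with the marks, so the geometric
    truncation becomes the one defined by the Gram matrix. *)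
Lemma dual_coord_truncation s z : independent F s ->
  @dual_coord _ _ _ ip F s @^-1` truncation ip F s z =
  [set y | truncated (gram ip F) s z (set_coord y)].
Proof.
move=> fs; apply/seteqP; split=> y /=.
  move=> /truncationP[a az ya]; exists a => // k ks.
  by rewrite gram_appE -ya dual_coordE comb_dual.
move=> [a az ya]; apply/truncationP; exists a => //.
apply/eqP; rewrite -subr_eq0; apply/eqP.
apply: (@dot_span0 _ _ ip [seq mark F i | i <- enum s]).
  by rewrite memvB ?comb_span// dual_coordE dual_span.
move=> x /mapP[i]; rewrite mem_enum => is_ ->.
by rewrite dotBl -gram_appE dual_coordE comb_dual// ya// subrr.
Qed.

Lemma dual_coord_simplex s : independent F s ->
  @dual_coord _ _ _ ip F s @^-1` fundamental_simplex ip F s =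
  [set y | simplex (enum s) 1 (set_coord y)].
Proof.
move=> fs; apply/seteqP; split=> y /=.
  move=> [a [a0 a1 ya]]; have E i : i \in s -> set_coord y i = a i.
    move=> is_; have /(congr1 (fun v => ip v (mark F i))) := ya.
    by rewrite dual_coordE !comb_dual.
  split=> [i|]; first by rewrite mem_enum => is_; rewrite E.
  by rewrite big_enum/= (eq_bigr _ E).
move=> [y0]; rewrite big_enum/= => y1.
exists (fun i => if i \in s then set_coord y i else 0).
split=> [i||]; first by case: ifP => // is_; rewrite y0// mem_enum.
  by rewrite (le_trans _ y1)// le_eqVlt; apply/orP; left; apply/eqP/eq_bigr => i ->.
by rewrite dual_coordE; apply: eq_bigr => i ->.
Qed.

(** The factor 1/n! of the truncation cancels against the volume of the fundamental simplex. *)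
Lemma cone_vol_truncation s z : independent F s -> pscub (gram ip F) s z ->
  cone_vol ip F s (truncation ip F s z) = cone_mvol (gram ip F) s (nseq #|s| z).
Proof.
move=> fs zs; rewrite /cone_vol dual_coord_truncation// dual_coord_simplex//.
have se : size (enum s) = #|s| by rewrite -cardE.
rewrite !(lebesgue_tuple_ileb _ _ se (enum_uniq _)).
rewrite (ileb_truncated _ (gram_pd ip fs) zs se (enum_uniq _)); last first.
  by move=> i; rewrite mem_enum.
rewrite ileb_simplex ?enum_uniq// se /= expr1n.
have : (#|s|)`!%:R != 0 :> R by rewrite pnatr_eq0 -lt0n fact_gt0.
by move=> n0; field.
Qed.

(** Half-spaces of the whole space must also cut out the span: [p e] is the component of [e]
    orthogonal to it, and the pair of signs forces [ip v (p e) = 0]. The dual vectors read off the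
    coefficients on the marks, which gives the inequalities of the cone. *)
Definition affine_hs s z : seq (V * R) :=
  let p e := e - \sum_(k in s) ip (dual_mark ip F s k) e *: mark F k in
  [seq (p e, 0) | e <- vbasis fullv] ++ [seq (- p e, 0) | e <- vbasis fullv] ++
  [seq (- dual_mark ip F s i, 0) | i <- enum s] ++ [seq (mark F i, z i) | i <- enum s].

Lemma truncation_halfspaces s z : independent F s ->
  truncation ip F s z = [set v | forall h, h \in affine_hs s z -> ip v h.1 <= h.2].
Proof.
move=> fs.
have pE v e : ip v (e - \sum_(k in s) ip (dual_mark ip F s k) e *: mark F k) =
    ip (v - \sum_(k in s) ip v (mark F k) *: dual_mark ip F s k) e.
  rewrite dotC dotBl [RHS]dotBl !dot_suml [ip e v]dotC; congr (_ - _).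
  by apply: eq_bigr => k _; rewrite mulrC [ip (mark F k) v]dotC.
have spanE v : v \in cone_span F s -> v = \sum_(k in s) ip v (mark F k) *: dual_mark ip F s k.
  move=> vs; apply/eqP; rewrite -subr_eq0; apply/eqP.
  apply: (@dot_span0 _ _ ip [seq mark F i | i <- enum s]).
    by rewrite memvB ?dual_span.
  move=> x /mapP[i]; rewrite mem_enum => is_ ->.
  by rewrite dotBl (comb_dual (fun k => ip v (mark F k)))// subrr.
have dE a i : i \in s -> ip (comb F s a) (dual_mark ip F s i) = a i.
  move=> is_; rewrite dot_suml (bigD1 i)//= dotC dot_dual// eqxx mulr1.
  rewrite big1 ?addr0// => k /andP[ks ki].
  by rewrite dotC dot_dual// (negPf ki) mulr0.
have oppE v e : (ip v (- e) <= 0) = (0 <= ip v e).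
  by rewrite dotC -scaleN1r dotZl mulN1r oppr_le0 dotC.
apply/seteqP; split=> v /=.
  move=> /truncationP[a [a0 az] ->] h; rewrite !mem_cat => /or4P[] /mapP[x] + -> /=.
  - by move=> _; rewrite pE -spanE ?comb_span// subrr linear0l.
  - by move=> _; rewrite oppE pE -spanE ?comb_span// subrr linear0l.
  - by rewrite mem_enum => xs; rewrite oppE dE// a0.
  - by rewrite mem_enum => xs; rewrite -gram_appE az.
move=> hv.
have vE : v = \sum_(k in s) ip v (mark F k) *: dual_mark ip F s k.
  apply/eqP; rewrite -subr_eq0; apply/eqP; set v' := v - _.
  apply: (@dot_span0 _ _ ip (vbasis fullv)); first by rewrite (span_basis (vbasisP _)) memvf.
  move=> e eb; rewrite -pE; apply/eqP; rewrite eq_le; apply/andP; split.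
    apply: (hv (_, 0)); rewrite mem_cat; apply/orP; left; apply/mapP; by exists e.
  rewrite -oppE; apply: (hv (_, 0)); rewrite !mem_cat; apply/orP; right; apply/orP; left.
  by apply/mapP; exists e.
have vs : v \in cone_span F s by rewrite vE dual_span.
have [a va aE] := span_comb ip fs vs.
apply/truncationP; exists a => //; split=> i is_.
  rewrite -(dE a)// -va -oppE; apply: (hv (_, 0)).
  by rewrite !mem_cat; apply/or4P/Or43/mapP; exists i; rewrite ?mem_enum.
rewrite aE//; apply: (hv (_, z i)).
by rewrite !mem_cat; apply/or4P/Or44/mapP; exists i; rewrite ?mem_enum.
Qed.

Lemma truncation_polytope s z : independent F s -> pscub (gram ip F) s z ->
  polytope_in ip (cone_span F s) (truncation ip F s z).
Proof.
move=> fs zs; split; last first.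
  by move=> v /truncationP[a _ ->]; exact: comb_span.
split.
- exists 0; apply/truncationP; exists (fun=> 0); last first.
    by rewrite /comb big1// => i _; rewrite scale0r.
  split=> // k ks; rewrite /gram_app big1 => [|l _]; last by rewrite mulr0.
  exact: (pscub_ge0 (gram_pd ip fs) zs).
- have [ws wE] := wvecP ip z fs; set w := wvec ip F s z in ws wE.
  exists (ip w w) => v /truncationP[a [a0 az] va].
  (* The vector [v] has nonnegative coefficients on the marks, and its products with them are at
     most those of [w]. Together with [0 <= ip (v - w) (v - w)] this bounds [ip v v] by [ip w w]. *)
  have vv : ip v v <= ip v w.
    have E u : ip v u = \sum_(i in s) a i * ip (mark F i) u by rewrite va dot_suml.
    rewrite !E; apply: ler_sum => i is_; apply: ler_wpM2l; first exact: a0.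
    by rewrite dotC [leRHS]dotC wE// va -gram_appE az.
  have := dot_ge0 ip (v - w).
  rewrite dotBl dotC dotBl [ip w (v - w)]dotC dotBl [ip w v]dotC; lra.
- by exists (affine_hs s z); exact: truncation_halfspaces.
Qed.

Lemma truncationD s x y : independent F s -> pscub (gram ip F) s x ->
  pscub (gram ip F) s y -> truncation ip F s (x \+ y) =
  minkowski 1 1 (truncation ip F s x) (truncation ip F s y).
Proof.
move=> fs xs ys; apply/seteqP; split=> v.
  move=> /truncationP[a az ->].
  have [b [b' [bx by' ab]]] := incone_split (gram_pd ip fs) xs ys az.
  exists (comb F s b); first by apply/truncationP; exists b.
  exists (comb F s b'); first by apply/truncationP; exists b'.
  rewrite !scale1r -big_split/=; apply: eq_bigr => i is_.
  by rewrite ab// scalerDl.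
move=> [_ /truncationP[b bx ->]] [_ /truncationP[b' by' ->]] <-.
apply/truncationP; exists (b \+ b'); first exact: incone_add.
by rewrite !scale1r -big_split; apply: eq_bigr => i _; rewrite scalerDl.
Qed.

End ConeVolume.

(** * Mixed volumes of truncations on a single cone *)

Section MixedVolumeOfTruncations.
Context {R : realType} {V : vectType R} {I : finType}.
Variables (ip : {dot V for idfun}) (F : marked_fan V I) (s : {set I}).
Hypothesis fs : independent F s.
Implicit Types (z a : I -> R) (v : V).

Local Notation trunc := (truncation ip F s).
Local Notation C := (pscub (gram ip F) s).

Lemma truncation0 v : trunc 0 v <-> v = 0.
Proof.
split=> [/truncationP[a [a0 az] ->]|->]; last first.
  apply/truncationP; exists (fun=> 0); last by rewrite /comb big1// => i _; rewrite scale0r.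
  by split=> // k ks; rewrite /gram_app big1// => l _; rewrite mulr0.
rewrite /comb big1// => i is_; have [->|ai] := eqVneq (a i) 0; first by rewrite scale0r.
have := pd_gt0 (gram_pd ip fs) (ex_intro2 _ (fun i => a i != 0) i is_ ai).
rewrite ltNge sumr_le0// => k ks; rewrite mulr_ge0_le0 ?a0//.
exact: (az k ks).
Qed.

Lemma truncation_sum (J : eqType) (js : seq J) (z : J -> I -> R) v : uniq js ->
  (forall k, C (z k)) -> trunc (\sum_(k <- js) z k) v <->
  exists2 p : J -> V, (forall k, k \in js -> trunc (z k) (p k)) & v = \sum_(k <- js) p k.
Proof.
move=> + Cz; elim: js v => [|j js IH] v /=.
  move=> _; rewrite big_nil truncation0; split=> [->|[p _ ->]]; last by rewrite big_nil.
  by exists (fun=> 0); rewrite ?big_nil.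
move=> /andP[jjs ujs]; rewrite big_cons.
have Cs : C (\sum_(k <- js) z k).
  by apply: big_ind => //; [exact: pscub0|exact: pscubD].
rewrite [X in trunc X](_ : _ = z j \+ \sum_(k <- js) z k)// truncationD//; split.
  move=> [p1 p1z [p2 /IH[//|p pz ->]]] <-.
  exists (fun k => if k == j then p1 else p k) => [k|].
    by rewrite inE; case: eqVneq => [->//|_ /=]; exact: pz.
  rewrite big_cons eqxx !scale1r; congr (_ + _); apply: eq_big_seq => k kjs.
  by case: eqVneq => // kj; rewrite -kj kjs in jjs.
move=> [p pz ->]; rewrite big_cons; exists (p j); first by apply: pz; rewrite mem_head.
exists (\sum_(k <- js) p k); last by rewrite !scale1r.
by apply/IH => //; exists p => // k kjs; apply: pz; rewrite inE kjs orbT.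
Qed.

Lemma minkowski_sum_truncation d (z : 'I_d -> I -> R) (S : {set 'I_d}) :
  (forall k, C (z k)) ->
  minkowski_sum S (fun k => trunc (z k)) = trunc (\sum_(k in S) z k).
Proof.
move=> Cz; rewrite -big_enum/=; apply/seteqP; split=> v.
  move=> [p pz ->]; rewrite -big_enum/=; apply/(truncation_sum _ (enum_uniq _) Cz).
  by exists p => // k; rewrite mem_enum; exact: pz.
move=> /(truncation_sum _ (enum_uniq _) Cz)[p pz ->]; exists p; last by rewrite big_enum.
by move=> k kS; apply: pz; rewrite mem_enum.
Qed.

Definition mvol_of d (z : 'I_d -> I -> R) : R :=
  cone_mvol (gram ip F) s [seq z k | k <- enum 'I_d].

Lemma mvol_of_multiadditive d : multiadditive C (@mvol_of d).
Proof.
move=> z k x y _ _ _; rewrite /mvol_of.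
have : k \in enum 'I_d by rewrite mem_enum.
have := enum_uniq 'I_d; move: (enum _) => js + /splitPr jj.
case: jj => l1 l2; rewrite uniq_catC /= mem_cat negb_or => /andP[/andP[k2 k1] _].
have E u l : k \notin l -> [seq set_arg z k u i | i <- l] = [seq z i | i <- l].
  move=> kl; apply/eq_in_map => i il; rewrite /set_arg.
  by case: eqVneq => // ik; rewrite -ik il in kl.
rewrite !map_cat /= !E//; rewrite /set_arg !eqxx; exact: cone_mvolD.
Qed.

Lemma mvol_of_perm d (z : 'I_d -> I -> R) (pi : {perm 'I_d}) :
  mvol_of (z \o pi) = mvol_of z.
Proof.
rewrite /mvol_of (map_comp z pi); apply: cone_mvol_perm; first exact: gram_pd.
rewrite perm_sym; apply: uniq_perm; first exact: enum_uniq.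
  by rewrite map_inj_uniq ?enum_uniq//; exact: perm_inj.
move=> k; rewrite mem_enum; apply/esym/mapP.
exists (pi^-1%g k); first by rewrite mem_enum.
by rewrite permKV.
Qed.

Lemma mvol_of_diag d x : #|s| = d -> C x ->
  mvol_of (fun _ : 'I_d => x) = cone_vol ip F s (trunc x).
Proof.
move=> sd Cx; rewrite cone_vol_truncation// sd /mvol_of; congr cone_mvol.
apply: (@eq_from_nth _ x); rewrite size_map size_enum_ord ?size_nseq// => i id.
by rewrite nth_nseq id; case: d {sd} id => // d id; rewrite (nth_map ord0) ?size_enum_ord.
Qed.

(** Both outcomes of [xget] lead to the same value. The default is the polarization formula,
    evaluated through Minkowski sums of truncations; a chosen [mv] is symmetric and additive on
    truncations with the same diagonal as [mvol_of], so [polarization_identity] forces them to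
    agree. *)
Lemma mixed_volume_truncation d (z : 'I_d -> I -> R) : #|s| = d -> (forall k, C (z k)) ->
  mixed_volume ip (cone_span F s) (cone_vol ip F s) (fun k => trunc (z k)) = mvol_of z.
Proof.
move=> sd Cz.
have C0 : C 0 by exact: pscub0.
have CD : forall x y, C x -> C y -> C (x + y) by move=> x y; exact: pscubD.
have CS (S : {set 'I_d}) : C (\sum_(k in S) z k) by exact: closed_sum.
have d0 : (d`!)%:R != 0 :> R by rewrite pnatr_eq0 -lt0n fact_gt0.
have M := polarization_identity C0 CD (@mvol_of_multiadditive d)
  (fun (u : 'I_d -> I -> R) pi _ => mvol_of_perm u pi) Cz.
rewrite /mixed_volume; case: xgetP => [mv _ mvP|_]; last first.
  rewrite /polarization; apply: (mulfI d0); rewrite mulVKf// -M.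
  by apply: eq_bigr => S _; rewrite minkowski_sum_truncation// mvol_of_diag.
have P x : C x -> polytope_in ip (cone_span F s) (trunc x) by exact: truncation_polytope.
pose Phi (u : 'I_d -> I -> R) := mv (fun k => trunc (u k)).
have PhiD : multiadditive C Phi.
  move=> u k x y Cu Cx Cy.
  have E w : (fun l => trunc (set_arg u k w l)) = replace_at (fun k => trunc (u k)) k (trunc w).
    by apply/funext => l; rewrite /set_arg /replace_at; case: eqP.
  rewrite /Phi !E truncationD//.
  rewrite (mv_lin mvP)// ?mul1r// => [l||]; [exact: P|exact: P|exact: P].
have PhiC u (pi : {perm 'I_d}) : (forall k, C (u k)) -> Phi (u \o pi) = Phi u.
  move=> Cu; rewrite /Phi. exact: (mv_sym mvP pi (fun k => P _ (Cu k))).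
apply: (mulfI d0); rewrite -M -(polarization_identity C0 CD PhiD PhiC Cz).
apply: eq_bigr => S _; rewrite mvol_of_diag//; congr (_ * _).
by apply: (mv_diag mvP); exact: P.
Qed.

End MixedVolumeOfTruncations.

(** * Faces and stars *)

Section Faces.
Context {R : realType} {V : vectType R} {I : finType}.
Variables (ip : {dot V for idfun}) (F : marked_fan V I).
Implicit Types (s t r : {set I}) (v : V).

Lemma fan_cone_face s r : independent F s -> r \subset s ->
  is_face (fan_cone F r) (fan_cone F s).
Proof.
(* Pairing with [D] is 0 on the marks in [r] and 1 on the other marks of [s], so it supports the
   face spanned by [r]. *)
move=> fs rs; pose D := \sum_(i in s :\: r) 1 *: dual_mark ip F s i.
pose f : 'Hom(V, R^o) := linfun (ip D).
have fE a : (f (comb F s a) : R) = \sum_(i in s :\: r) a i.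
  rewrite lfunE /= dot_suml; apply: eq_bigr => i; rewrite inE => /andP[_ is_].
  rewrite mul1r dotC dot_suml (bigD1 i)//= dotC dot_dual// eqxx mulr1.
  by rewrite big1 ?addr0// => k /andP[ks ki]; rewrite dotC dot_dual// (negPf ki) mulr0.
exists f => [v /fan_coneP[a a0 ->]|].
  by rewrite fE sumr_ge0// => i; rewrite inE => /andP[_ is_]; exact: a0.
apply/seteqP; split=> v.
  move=> /fan_coneP[a a0 ->]; pose b i := if i \in r then a i else 0.
  have -> : comb F r a = comb F s b.
    rewrite /comb [RHS](big_setID r)/= (finset.setIidPr rs) [X in _ + X]big1 ?addr0.
      by apply: eq_bigr => i ir; rewrite /b ir.
    by move=> i; rewrite inE /b => /andP[/negPf -> _]; rewrite scale0r.
  split; first by apply/fan_coneP; exists b => // i _; rewrite /b; case: ifP => // /a0.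
  by rewrite fE big1// => i; rewrite inE /b => /andP[/negPf -> _].
move=> [/fan_coneP[a a0 ->]]; rewrite fE => /eqP; rewrite psumr_eq0; last first.
  by move=> i; rewrite inE => /andP[_ is_]; exact: a0.
move=> /allP a_eq0; apply/fan_coneP; exists a => [i ir|].
  by rewrite a0// (fintype.subsetP rs).
rewrite /comb (big_setID r)/= (finset.setIidPr rs) [X in _ + X]big1 ?addr0// => i is_.
by have := a_eq0 i (mem_index_enum i); rewrite is_ => /eqP->; rewrite scale0r.
Qed.

Lemma fan_cone_span s v : fan_cone F s v -> v \in cone_span F s.
Proof. by move=> /fan_coneP[a _ ->]; exact: comb_span. Qed.

(** A face is only known to equal some [fan_cone F t] as a set of points. The rays of that face are
    labels of [t], so [r \subset t], and comparing dimensions gives [r = t]. *)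
Lemma subcone s r : is_fan F -> is_simplicial F -> s \in cones F -> r \subset s ->
  r \in cones F.
Proof.
move=> fanF simF sF rs; have fs : independent F s by apply/independentP/simF.
have fr := independent_sub rs fs.
have [t tF rt] := fan_face fanF sF (fan_cone_face fs rs).
have r_t : r \subset t.
  apply/fintype.subsetP => i ir; apply/(fan_raysP fanF tF).
    by apply: (fintype.subsetP (fan_sub_rays fanF sF)); exact: (fintype.subsetP rs).
  by rewrite -rt; apply: fan_cone_face => //; rewrite finset.sub1set.
suff -> : r = t by [].
apply/eqP; rewrite eqEcard r_t -(simF t tF) -((independentP F r).2 fr).
apply/dimvS/span_subvP => _ /mapP[i + ->]; rewrite mem_enum => it.
apply: fan_cone_span; rewrite rt; apply/fan_coneP.
exists (fun j => (j == i)%:R) => //; rewrite /comb (bigD1 i)//= eqxx scale1r.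
by rewrite big1 ?addr0// => j /andP[_ /negPf ->]; rewrite scale0r.
Qed.

(** Lets the independence of projected marks be read off from their Schur complement. *)
Lemma pd_independent s : pos_def (gram ip F) s -> independent F s.
Proof.
move=> gs a a0; apply: (pd_inj gs) => k ks.
by rewrite gram_appE a0 linear0l.
Qed.

End Faces.

(** * The star at a ray as a Schur complement *)

Section Star.
Context {R : realType} {V : vectType R} {I : finType}.
Variables (ip : {dot V for idfun}) (F : marked_fan V I) (i : I).
Hypothesis i_neq0 : mark F i != 0.
Implicit Types (q s : {set I}) (v : V) (z : I -> R).

Local Notation g := (gram ip F).
Local Notation star_i := (star ip F [set i]%SET).
Local Notation sdot := (star_dot ip F [set i]%SET).

Lemma gram_neq0 : g i i != 0.
Proof. by rewrite gt_eqF// (neq0_dnorm_gt0 (s := ip)). Qed.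

Lemma cone_span1 : cone_span F [set i]%SET = <[mark F i]>%VS.
Proof. by rewrite /cone_span enum_set1 span_seq1. Qed.

Lemma independent1 : independent F [set i]%SET.
Proof. by apply/independentP; rewrite cone_span1 dim_vline i_neq0 cards1. Qed.

Lemma star_projE v : vsval (star_proj ip F [set i]%SET v) =
  v - (ip v (mark F i) / g i i) *: mark F i.
Proof.
rewrite /star_proj vsprojK ?memv_pi//; set U := star_space _ _ _; set W := cone_span _ _.
have UW : (U :&: W = 0)%VS.
  apply/eqP; rewrite -subv0; apply/subvP => x /memv_capP[xU xW]; rewrite memv0.
  by apply/eqP/(dot_eq0 (ip := ip)); move/mem_orthovP: xU; apply.
have uW : mark F i \in W by rewrite /W cone_span1 memv_line.
set x := v - _.
have xU : x \in U.
  apply/mem_orthovP => y; rewrite /W cone_span1 => /vlineP[k ->].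
  rewrite [LHS](dotZr ip k x) /x dotBl dotZl divfK ?gram_neq0// subrr mulr0//.
have u0 : daddv_pi U W (mark F i) = 0.
  have uUW : mark F i \in (U + W)%VS by apply: (subvP (addvSr U W)).
  have := daddv_pi_add UW uUW; rewrite addrC.
  have -> : daddv_pi W U (mark F i) = mark F i.
    by apply: daddv_pi_id uW; rewrite capvC.
  by rewrite -[RHS]addr0 => /addrI.
have -> : v = x + (ip v (mark F i) / g i i) *: mark F i by rewrite subrK.
rewrite linearD linearZ/= u0 scaler0 addr0.
exact: daddv_pi_id xU.
Qed.

Lemma gram_star : gram sdot star_i = schur g i.
Proof.
apply/funext => j; apply/funext => k.
rewrite [LHS]/gram /= [LHS]/restr_form !star_projE.
rewrite /schur /schur_val !dotBl !dotZl.
rewrite [ip (mark F j) (_ - _)]dotC [ip (mark F i) (_ - _)]dotC.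
rewrite !dotBl !dotZl -!/(g _ _).
have gC a b : g a b = g b a by exact: dotC.
rewrite (gC k j) (gC i j) (gC k i).
by have g0 := gram_neq0; field.
Qed.

Lemma star_valueE z : star_value ip F [set i]%SET z = schur_val g i z.
Proof.
apply/funext => j; rewrite /star_value /schur_val; congr (_ - _).
have [ws wE] := wvecP ip z independent1; set w := wvec _ _ _ _ in ws wE *.
move: ws wE; rewrite cone_span1 => /vlineP[c ->] /(_ i); rewrite inE eqxx => /(_ isT).
rewrite !dotZl => <-; rewrite -!/(g _ _) (_ : g j i = g i j); last exact: dotC.
by have g0 := gram_neq0; field.
Qed.

(** On both sides the dimension is the number of labels, and adjoining [i] raises it by one.
    Independence in the star comes from the definiteness of the Schur complement. *)
Lemma star_cones_dim q d : is_fan F -> is_simplicial F ->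
  (q \in cones_dim star_i d) = (i \notin q) && ((i |: q)%SET \in cones_dim F d.+1).
Proof.
move=> fanF simF.
have E : i \notin q -> (i |: q)%SET \in cones F ->
    (\dim (cone_span star_i q) == d) = (\dim (cone_span F (i |: q)%SET) == d.+1).
  move=> iq sF; rewrite simF// cardsU1 iq add1n eqSS.
  have fs : independent F (i |: q)%SET by apply/independentP/simF.
  rewrite (independentP star_i q).2//.
  apply: (@pd_independent _ _ _ sdot); rewrite gram_star.
  by rewrite -(setU1K iq); apply: (pd_schur (gram_pd ip fs)); rewrite setU11.
rewrite !inE; apply/andP/andP => [[/imsetP[p]]|[iq /andP[sF sd]]].
  rewrite inE => /andP[pF /exists_inP[s sF /andP[is_ ps]]] qp qd; subst q.
  have iq : i \notin p :\ i by rewrite !inE eqxx.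
  have sF' : (i |: (p :\ i))%SET \in cones F.
    apply: (subcone ip fanF simF sF); rewrite finset.subUset is_/=.
    exact: fintype.subset_trans (subD1set _ _) ps.
  by split=> //; rewrite sF' -E.
rewrite E//; split=> //; apply/imsetP; exists (i |: q)%SET; last by rewrite setU1K.
rewrite inE sF; apply/exists_inP; exists (i |: q)%SET => //.
by rewrite finset.sub1set setU11 subxx.
Qed.

End Star.

Theorem proposition4p13 (R : realType) (V : vectType R) (I : finType) (d : nat)
    (F : marked_fan V I) (w : {set I} -> R) (ip : {dot V for idfun})
    (z : 'I_d.+1 -> I -> R) :
  is_fan F -> is_pure F d.+1 -> is_simplicial F ->
  (forall s, s \in cones_dim F d.+1 -> 0 < w s) ->
  (forall k, pseudocubical ip F (z k)) ->
  MVol ip F w z =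
    \sum_(i in rays F)
      z ord0 i *
      MVol (star_dot ip F [set i]) (star ip F [set i])
           (star_weight [set i] w)
           (fun k : 'I_d => star_value ip F [set i] (z (lift ord0 k))).
Proof.
move=> fanF _ simF _ zF; pose g := gram ip F.
have sP s : s \in cones_dim F d.+1 -> [/\ s \in cones F, independent F s & #|s| = d.+1].
  rewrite inE => /andP[sF /eqP sd]; have fs : independent F s by apply/independentP/simF.
  by split=> //; rewrite -(simF s sF).
have zP s k : s \in cones F -> independent F s -> pscub g s (z k).
  move=> sF fs; apply: pscub_pseudocubical => // t ts.
  exact: (subcone ip fanF simF sF).
pose M i s := cone_mvol (schur g i) (s :\ i)
  [seq schur_val g i (z (lift ord0 k)) | k <- enum 'I_d].
transitivity (\sum_(s in cones_dim F d.+1) \sum_(i in s) w s * (z ord0 i * M i s)).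
  apply: eq_bigr => s /sP[sF fs sd]; rewrite mixed_volume_truncation//; last first.
    by move=> k; exact: zP.
  rewrite -mulr_sumr; congr (_ * _).
  rewrite /mvol_of enum_ordSl /= cone_mvol_cons; apply: eq_bigr => i _.
  by rewrite /M -!map_comp.
rewrite (exchange_big_dep [in rays F])/= => [|s i /sP[sF _ _]]; last first.
  exact/fintype.subsetP/(fan_sub_rays fanF).
apply: eq_bigr => i iF; have i0 := fan_mark_neq0 fanF iF.
rewrite /MVol mulr_sumr.
(* The maximal cones through the ray [i] are the [i |: q] for the maximal cones [q] of its star;
   [star_weight] assigns to [q] the weight of [i |: q]. *)
rewrite (reindex_onto (fun q => i |: q)%SET (fun s => s :\ i))/=; last first.
  by move=> s /andP[_ is_]; rewrite finset.setD1K.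
apply: eq_big => [q|q].
  rewrite star_cones_dim// setU11 andbT andbC; congr (_ && _).
  apply/eqP/idP => [<-|iq]; last by rewrite finset.setU1K.
  by rewrite finset.setD11.
rewrite setU11 andbT => /andP[sd /eqP qE]; have [sF fs _] := sP _ sd.
have iq : i \notin q by rewrite -qE !inE eqxx.
rewrite mulrCA; congr (_ * (_ * _)).
have gs := gram_pd ip fs; have is_ := setU11 i q.
have gq : pos_def (gram (star_dot ip F [set i]%SET) (star ip F [set i]%SET)) q.
  by rewrite gram_star// -qE; exact: pd_schur.
rewrite mixed_volume_truncation.
- rewrite /mvol_of gram_star// /M qE; congr cone_mvol.
  by apply: eq_map => k; rewrite star_valueE.
- exact: pd_independent gq.
- have [_ _] := sP _ sd; rewrite cardsU1 iq => -[<-]//.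
- move=> k; rewrite gram_star// star_valueE// -qE; apply: pscub_schur => //.
  exact: zP.
Qed.
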